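(* Let $X$ be a real random variable with $\mathbb{E}|X|<\infty$ and $\mathbb{E}X<0$ satisfying assumptions (A1), (A2), (A3) listed in the context, where $\alpha>1$ is the tail index in (A1). Let $Z$ be a random variable independent of $X$ with the residual life distribution of $X$: $$\mathbb{P}(Z>t)=\min\Big\{1,\frac{1}{|\mathbb{E}X|}\int_t^\infty\mathbb{P}(X>s)\,\mathrm{d}s\Big\}\quad\text{for all } t\in\mathbb{R}.$$ Then: (i) If $\alpha\in(1,3/2)$, then $\mathbb{P}(X+Z>t)\le\mathbb{P}(Z>t)$ for all sufficiently large $t>0$. (ii) If $\alpha\in(3/2,2)$, then $\mathbb{P}(X+Z>t)\ge\mathbb{P}(Z>t)$ for all sufficiently large $t>0$.
   Context: Notation: $x^+=\max\{x,0\}$, $x^-=-\min\{x,0\}$; $f(t)\sim g(t)$ means $f(t)/g(t)\to 1$ as $t\to\infty$. Assumptions: (A1) The right tail is regularly varying with tail index $\alpha>1$: for all $u>0$, $\mathbb{P}(X>ut)\sim u^{-\alpha}\mathbb{P}(X>t)$ as $t\to\infty$ (in particular $\mathbb{P}(X>t)>0$ for all $t$). (A2) There exists a function $h$ with $h(t)\to\infty$, $h(t)=o(t)$ and $\int_{h(t)}^\infty \mathbb{P}(X^->s)\,\mathrm{d}s=o\big(t\,\mathbb{P}(X^+>t)\big)$ as $t\to\infty$. (A3) The distribution of $X$ has a continuous density $f$ which is regularly varying with tail index $\alpha+1$, i.e. $f(ut)\sim u^{-(\alpha+1)}f(t)$ as $t\to\infty$ for all $u>0$. *)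

(* Defs.v *)
From HB Require Import structures.
From mathcomp Require Import all_boot all_order all_algebra.
From mathcomp Require Import all_classical all_reals all_analysis.

Set Implicit Arguments.
Unset Strict Implicit.
Unset Printing Implicit Defensive.
Import Order.TTheory GRing.Theory Num.Theory.
Import numFieldNormedType.Exports.
Local Open Scope classical_set_scope.
Local Open Scope ring_scope.

(* The Landau notation f =o_ F g infers a filter_on structure for F; the library
   declares none for pinfty_nbhs. *)
Canonical pinfty_filter_on (R : numFieldType) := FilterType (pinfty_nbhs R) _.

Section asymptotics.
Context {R : realType}.

(* As 0^-1 = 0, this limit forces g to be nonzero near +oo. *)
Definition asymp_equiv (f g : R -> R) : Prop :=
  f t / g t @[t --> +oo] --> (1 : R).

Definition regularly_varying (rho : R) (f : R -> R) : Prop :=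
  forall u : R, 0 < u ->
    asymp_equiv (fun t => f (u * t)) (fun t => u `^ (- rho) * f t).

End asymptotics.

Section random_variables.
Context {d : measure_display} {T : measurableType d} {R : realType}.
Variable P : probability T R.

Definition tail (X : T -> R) (t : R) : R := fine (P [set w | X w > t]).

Definition independent_RV (X Y : {RV P >-> R}) : Prop :=
  forall A B : set R, measurable A -> measurable B ->
    P (X @^-1` A `&` Y @^-1` B) = (P (X @^-1` A) * P (Y @^-1` B))%E.

(* Positivity of all the tail probabilities follows: asymp_equiv makes them
   nonzero near +oo, and they are nonincreasing. *)
Definition regularly_varying_tail (alpha : R) (X : {RV P >-> R}) : Prop :=
  regularly_varying alpha (tail X).

(* The real-valued integrals below, here and in residual_life, are meant for
   integrable X, for which they are finite. *)
Definition negligible_left_tail (X : {RV P >-> R}) : Prop :=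
  exists h : R -> R,
    [/\ h t @[t --> +oo] --> +oo,
        h =o_ (pinfty_nbhs R) (fun t => t)
      & (fun t => \int[lebesgue_measure]_(s in `[h t, +oo[) tail X^\- s)
          =o_ (pinfty_nbhs R) (fun t => t * tail X^\+ t)].

Definition continuous_density (X : {RV P >-> R}) (f : R -> R) : Prop :=
  [/\ continuous f,
      forall x, 0 <= f x
    & forall A : set R, measurable A ->
        distribution P X A = (\int[lebesgue_measure]_(x in A) (f x)%:E)%E].

Definition regularly_varying_density (alpha : R) (X : {RV P >-> R}) : Prop :=
  exists f : R -> R,
    continuous_density X f /\ regularly_varying (alpha + 1) f.

Definition residual_life (X Z : {RV P >-> R}) : Prop :=
  forall t : R,
    tail Z t = Num.min 1
      (`|fine 'E_P[X]|^-1 *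
         \int[lebesgue_measure]_(s in `[t, +oo[) tail X s).

End random_variables.

(* Main.v *)
(* Write F and B for the tails of X and Z, m = - E X and H t = E (X - t)^+, so that
   B = H / m near +oo, and B (t - X) averages to P(X + Z > t).  Splitting at
   X = t/2 and expanding H (t - x) around x = 0 to first order for x <= t/2, the
   leading terms F t cancel and m (P(X + Z > t) - P(Z > t)) is a sum of terms of
   order t (F t)^2.  Since H t ~ t F t / (alpha - 1) (Karamata), dividing by
   t (F t)^2 gives Riemann-Stieltjes integrals against d(-v^(-alpha)) of explicit
   functions of v = X / t; only monotonicity and pointwise regular variation are
   needed for their limits.  Their sum is, up to a positive factor,
     alpha int_0^(1/2) v^(1-alpha) (1-v)^(-alpha-1) dv - 2^(2 alpha - 1),
   which after v = w / (1 + w) is compared with 0 through the tangent of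
   (1 + w)^(2 alpha - 2) at w = 1: it is negative for alpha < 3/2 and positive for
   alpha > 3/2.  The contributions of small |X| and of X near t are nonnegative, so
   they only matter in case (i), where they are controlled by the Lipschitz bound
   F s - F s' <= C (F t / t) (s' - s) for t/2 <= s <= s' <= 2 t coming from the
   density, and by doubling arguments for truncated second moments. *)
Require Import Defs.
From HB Require Import structures.
From mathcomp Require Import all_boot all_order all_algebra.
From mathcomp Require Import all_classical all_reals all_analysis.
From mathcomp Require Import measurable_realfun.
From mathcomp Require Import ring lra.
Set Implicit Arguments.
Unset Strict Implicit.
Unset Printing Implicit Defensive.
Import Order.TTheory GRing.Theory Num.Theory.
Import numFieldNormedType.Exports.
Local Open Scope classical_set_scope.
Local Open Scope ring_scope.

(** Both probabilities are of order t F(t), but their difference is of order t F(t)^2. First-order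
    tail asymptotics therefore say nothing, and the expansion must be an exact identity before any
    limit is taken. The limiting integrands are singular, like v^(1-alpha) at 0 and (1-v)^(1-alpha)
    at 1, and the pointwise limits hold only away from these ends. Hence the cuts at [e * t] and
    [(1 - e) * t]: the discarded pieces of the range X > 0 and the boundary terms of the
    antiderivatives are all O(e^(2-alpha)), and [e] is fixed once the sign of the limit is known. On
    the range X < 0, assumption (A2) makes the contribution vanish in the limit. The Lipschitz bound
    asks for a comparison of density values uniform over [t/2, 2t], whereas (A3) is pointwise in the
    ratio; continuity and Baire's theorem bridge that gap. *)

Section tails.
Context {d : measure_display} {T : measurableType d} {R : realType}.
Variable P : probability T R.

Lemma measurable_gt (Y : {mfun T >-> R}) (t : R) : measurable [set w | t < Y w].
Proof.
rewrite [X in measurable X](_ : _ = Y @^-1` `]t, +oo[); first exact: measurable_funPTI.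
by apply/seteqP; split => w /=; rewrite in_itv/= andbT.
Qed.

Lemma tail_ge0 (Y : T -> R) t : 0 <= tail P Y t.
Proof. exact: fine_ge0. Qed.

Lemma tail_nonincr (Y : {mfun T >-> R}) : {homo tail P Y : s t / s <= t >-> t <= s}.
Proof.
move=> s t st; rewrite /tail fine_le ?fin_num_measure//; try exact: measurable_gt.
rewrite le_measure ?inE//; try exact: measurable_gt.
by move=> w /=; exact: le_lt_trans.
Qed.

Lemma tail_le1 (Y : {mfun T >-> R}) t : tail P Y t <= 1.
Proof.
rewrite /tail -lee_fin fineK ?fin_num_measure//; last exact: measurable_gt.
exact/probability_le1/measurable_gt.
Qed.

Lemma measurable_tail (Y : {mfun T >-> R}) : measurable_fun setT (tail P Y).
Proof. by apply: nonincreasing_measurable => // s t; exact: tail_nonincr. Qed.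

Lemma tail_Rintegral (Y : {mfun T >-> R}) t :
  tail P Y t = \int[P]_w ((t < Y w)%R%:R : R).
Proof.
rewrite /tail -[X in P X]setIT -integral_indic//; last exact: measurable_gt.
congr fine; apply: eq_integral => w _; rewrite indicE.
by case: (boolP (t < Y w)) => h; [rewrite mem_set|rewrite memNset//=; apply/negP].
Qed.

(** Tonelli for the indicator of [t <= s < Y w], integrated over [s] first. The integrated tails in
    the hypotheses thus become expectations, for which convexity estimates are pointwise. *)
Lemma Rintegral_tail (Y : {mfun T >-> R}) t :
  \int[lebesgue_measure]_(s in `[t, +oo[) tail P Y s =
  \int[P]_w (Num.max (Y w - t) 0).
Proof.
rewrite /Rintegral; congr fine.
pose GR := measurableTypeR R.
pose g (p : T * GR) : \bar R := (\1_[set q : T * GR | t <= q.2 < Y q.1] p)%:E.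
transitivity (\int[lebesgue_measure]_s \int[P]_w g (w, s))%E.
  rewrite integral_mkcond; apply: eq_integral => s _.
  rewrite patchE; case: ifPn => [|].
    rewrite inE/= in_itv/= andbT => ts.
    rewrite /tail fineK ?fin_num_measure//; last exact: measurable_gt.
    rewrite -[X in P X]setIT -integral_indic//; last exact: measurable_gt.
    apply: eq_integral => w _; rewrite /g !indicE; congr ((nat_of_bool _)%:R%:E).
    by apply/idP/idP; rewrite !inE/= ts.
  rewrite notin_setE/= in_itv/= andbT => /negP ts.
  rewrite integral0_eq// => w _; rewrite /g indicE memNset//=.
  by rewrite (negbTE ts).
rewrite -(@fubini_tonelli _ _ _ _ _ P (@lebesgue_measure R))//; last 2 first.
- apply/measurable_EFinP/measurable_indic => /=.
  rewrite [X in measurable X](_ : _ = (fun p : T * GR => (t <= p.2)%R) @^-1` [set true] `&`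
     (fun p : T * GR => (p.2 < Y p.1)%R) @^-1` [set true]); last first.
    by apply/seteqP; split => p /= /andP.
  apply: measurableI.
  - have : measurable_fun setT (fun p : T * GR => (t <= p.2)%R).
      exact: measurable_fun_ler.
    by move=> /(_ measurableT [set true]); rewrite setTI; exact.
  - have : measurable_fun setT (fun p : T * GR => (p.2 < Y p.1)%R).
      by apply: measurable_fun_ltr => //; exact: measurableT_comp.
    by move=> /(_ measurableT [set true]); rewrite setTI; exact.
- by move=> p; rewrite lee_fin.
apply: eq_integral => w _.
transitivity (\int[lebesgue_measure]_s (\1_(`[t, Y w[%classic : set R) s)%:E)%E.
  apply: eq_integral => s _; rewrite /g !indicE.
  suff -> : ((w, s) \in [set q : T * R | t <= q.2 < Y q.1]) = (s \in `[t, Y w[%classic) by [].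
  by apply/idP/idP; rewrite !inE/= ?in_itv.
rewrite integral_indic//= setIT lebesgue_measure_itv/= lte_fin.
have [h|h] := ltP t (Y w); first by rewrite -EFinD max_l// subr_ge0 ltW.
by rewrite max_r// subr_le0.
Qed.

(** Independence makes the joint law agree with the product law on rectangles, hence everywhere; the
    half-plane [t < x + z] is then measured along its sections at fixed [x]. *)
Lemma tail_add (X Z : {RV P >-> R}) t : independent_RV X Z ->
  tail P (fun w => X w + Z w) t = \int[P]_w (tail P Z (t - X w)).
Proof.
move=> indep.
pose mu := distribution P X; pose nu := distribution P Z.
pose W : T -> R * R := fun w => (X w, Z w).
have mW : measurable_fun setT W by apply/measurable_fun_pairP.
pose WM : {mfun T >-> (R * R)%type} := mfun_Sub (mem_set mW).
pose A := [set p : R * R | t < p.1 + p.2].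
have mA : measurable A.
  have : measurable_fun setT (fun p : R * R => (t < p.1 + p.2)%R).
    by apply: measurable_fun_ltr => //; exact: measurable_funD.
  by move=> /(_ measurableT [set true]); rewrite setTI; exact.
have muW : (mu \x nu)%E A = distribution P WM A.
  by apply: product_measure_unique => // B C mB mC; exact: indep.
have -> : tail P (fun w => X w + Z w) t = fine ((mu \x nu)%E A) by rewrite muW.
rewrite /Rintegral; congr fine.
rewrite /product_measure1 ge0_integral_distribution//; last first.
  exact: measurable_fun_xsection.
apply: eq_integral => w _ /=.
rewrite /tail fineK ?fin_num_measure//; last exact: measurable_gt.
rewrite /nu /distribution /pushforward/=; congr (P _); apply/seteqP.
by split => x; rewrite /= /xsection/= inE/= ltrBlDl.
Qed.

End tails.

(** * Expectations of functions of X restricted to an interval *)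

Section truncated_expectation.
Context {d : measure_display} {T : measurableType d} {R : realType}.
Variables (P : probability T R) (X : {RV P >-> R}).
Hypothesis intX : P.-integrable [set: T] (EFin \o X).
Implicit Types (i : interval R) (g : R -> R).

Definition Eon i g : R := \int[P]_w ((X w \in i)%:R * g (X w)).

(** A sufficient condition for integrability, as [X] is integrable. Linear growth accommodates
    [H (t - x)], and asking for the bound only on [i] admits [x ^+ 2] on bounded intervals. *)
Definition affinely_bounded i g :=
  measurable_fun setT g /\ exists a b : R, {in i, forall x, `|g x| <= a + b * `|x|}.

Lemma integrable_Eon i g : affinely_bounded i g ->
  P.-integrable [set: T] (fun w => ((X w \in i)%:R * g (X w))%:E).
Proof.
move=> [mg [a [b gab]]].
have iab : P.-integrable [set: T] (EFin \o (fun w => `|a| + `|b| * `|X w|)).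
  rewrite (_ : _ \o _ = (fun w => `|a|%:E + `|b|%:E * `|(X w)%:E|)%E); last first.
    by apply/funext => w /=; rewrite EFinD EFinM.
  apply: integrableD => //; first exact: finite_measure_integrable_cst.
  by apply: integrableZl => //; apply: integrable_abse.
apply: le_integrable iab => //.
  apply/measurable_EFinP; apply: measurable_funM; last exact: measurableT_comp.
  rewrite (_ : (fun _ => _) = (\1_[set` i] : R -> R) \o X); last first.
    by apply/funext => w; rewrite /= indicE mem_setE.
  by apply: measurableT_comp => //; exact: measurable_indic.
move=> w _ /=; rewrite lee_fin normrM normr_nat [leRHS]ger0_norm; last first.
  by rewrite addr_ge0// mulr_ge0.
case: (boolP (X w \in i)) => Xi; last by rewrite mul0r addr_ge0// mulr_ge0.
rewrite mul1r (le_trans (gab _ Xi))// lerD ?ler_norm//; apply: ler_wpM2r => //; exact: ler_norm.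
Qed.

Lemma ab_cst i c : affinely_bounded i (fun=> c).
Proof.
by split; [exact: measurable_cst|exists `|c|, 0 => x _; rewrite mul0r addr0].
Qed.

Lemma ab_id i : affinely_bounded i id.
Proof.
by split; [exact: measurable_id|exists 0, 1 => x _; rewrite mul1r add0r].
Qed.

Lemma abD i g1 g2 : affinely_bounded i g1 -> affinely_bounded i g2 ->
  affinely_bounded i (fun x => g1 x + g2 x).
Proof.
move=> [m1 [a1 [b1 H1]]] [m2 [a2 [b2 H2]]]; split; first exact: measurable_funD.
exists (a1 + a2), (b1 + b2) => x xi.
rewrite (le_trans (ler_normD _ _))//.
by have := H1 _ xi; have := H2 _ xi; lra.
Qed.

Lemma abZ i c g : affinely_bounded i g -> affinely_bounded i (fun x => c * g x).
Proof.
move=> [m1 [a1 [b1 H1]]]; split; first exact: measurable_funM.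
exists (`|c| * a1), (`|c| * b1) => x xi.
by rewrite normrM -mulrA -mulrDr ler_wpM2l// H1.
Qed.

Lemma abS i j g : {subset i <= j} -> affinely_bounded j g -> affinely_bounded i g.
Proof.
by move=> ij [mg [a [b H]]]; split => //; exists a, b => x /ij; exact: H.
Qed.

Lemma le_Eon i g1 g2 : affinely_bounded i g1 -> affinely_bounded i g2 ->
  {in i, forall x, g1 x <= g2 x} -> Eon i g1 <= Eon i g2.
Proof.
move=> b1 b2 g12; apply: le_Rintegral => //; try exact: integrable_Eon.
move=> w _; case: (boolP (X w \in i)) => Xi; last by rewrite !mul0r.
by rewrite !mul1r g12.
Qed.

Lemma Eon_ge0 i g : {in i, forall x, 0 <= g x} -> 0 <= Eon i g.
Proof.
move=> g0; apply: Rintegral_ge0 => w _.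
by case: (boolP (X w \in i)) => Xi; rewrite ?mul0r// mul1r g0.
Qed.

Lemma eq_Eon i g1 g2 : {in i, g1 =1 g2} -> Eon i g1 = Eon i g2.
Proof.
move=> g12; apply: eq_Rintegral => w _.
by case: (boolP (X w \in i)) => Xi; rewrite ?mul0r// g12.
Qed.

Lemma EonD i g1 g2 : affinely_bounded i g1 -> affinely_bounded i g2 ->
  Eon i (fun x => g1 x + g2 x) = Eon i g1 + Eon i g2.
Proof.
move=> b1 b2; rewrite /Eon -RintegralD//; try exact: integrable_Eon.
by apply: eq_Rintegral => w _; rewrite mulrDr.
Qed.

Lemma EonZ i c g : affinely_bounded i g -> Eon i (fun x => c * g x) = c * Eon i g.
Proof.
move=> b; rewrite /Eon -RintegralZl//; last exact: integrable_Eon.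
by apply: eq_Rintegral => w _; rewrite mulrCA.
Qed.

Lemma Eon_split (l r : itv_bound R) c g :
  (l <= BRight c)%O -> (BRight c <= r)%O -> affinely_bounded (Interval l r) g ->
  Eon (Interval l r) g = Eon (Interval l (BRight c)) g + Eon (Interval (BRight c) r) g.
Proof.
move=> lc cr b.
rewrite /Eon -RintegralD//; [|apply: integrable_Eon..]; last 2 first.
- by apply: abS b; apply: subitvP; rewrite subitvE lexx.
- by apply: abS b; apply: subitvP; rewrite subitvE lexx andbT.
apply: eq_Rintegral => w _; rewrite -mulrDl -natrD; congr (_%:R * _).
rewrite !itv_boundlr; case: (leP (X w) c) => Xc.
  have -> : (BRight c <= BLeft (X w))%O = false by rewrite bnd_simp ltNge Xc.
  have h : (BRight (X w) <= BRight c)%O by rewrite bnd_simp.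
  by rewrite h (le_trans h cr) addn0.
have -> : (BRight (X w) <= BRight c)%O = false by rewrite bnd_simp leNgt Xc.
have h : (BRight c <= BLeft (X w))%O by rewrite bnd_simp.
by rewrite h (le_trans lc h) andbF add0n.
Qed.

Lemma Eon1_gt c : Eon `]c, +oo[ (fun=> 1) = tail P X c.
Proof.
rewrite tail_Rintegral; apply: eq_Rintegral => w _.
by rewrite in_itv/= andbT mulr1.
Qed.

Lemma Eon1_itv a b : a <= b -> Eon `]a, b] (fun=> 1) = tail P X a - tail P X b.
Proof.
move=> ab; rewrite -!Eon1_gt [in RHS](@Eon_split (BRight a) +oo%O b)//.
- by rewrite addrK.
- exact: ab_cst.
Qed.

Lemma EonT g : Eon `]-oo, +oo[ g = \int[P]_w g (X w).
Proof. by apply: eq_Rintegral => w _; rewrite in_itv/= mul1r. Qed.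

Lemma Eon_bounds i g c1 c2 : affinely_bounded i g ->
  {in i, forall x, c1 <= g x <= c2} ->
  c1 * Eon i (fun=> 1) <= Eon i g <= c2 * Eon i (fun=> 1).
Proof.
move=> bg gc; rewrite -!EonZ; try exact: ab_cst.
by apply/andP; split; apply: le_Eon => //; (try by apply: abZ; exact: ab_cst);
  move=> x /gc; rewrite mulr1 => /andP[].
Qed.

End truncated_expectation.

(** * Pointwise regular variation and elementary analysis of powers *)

Section regular_variation.
Context {R : realType}.
Implicit Types (f F U N : R -> R).

Lemma regularly_varying_ratio rho f (u : R) : regularly_varying rho f -> 0 < u ->
  f (u * t) / f t @[t --> +oo] --> u `^ (- rho).
Proof.
move=> rv u0; have := rv u u0; rewrite /asymp_equiv => h.
rewrite -[X in _ --> X]mulr1.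
rewrite (_ : (fun t => _) = (fun t => u `^ (- rho) * (f (u * t) / (u `^ (- rho) * f t)))).
  by apply: cvgMr h.
have c0 : u `^ (- rho) != 0 by rewrite gt_eqF// powR_gt0.
by apply/funext => t; rewrite invfM mulrCA (mulrA _ _^-1) divff ?mul1r.
Qed.

Lemma near_pinfty_scale (u : R) (A : set R) : 0 < u ->
  (\forall t \near +oo, A t) -> \forall t \near +oo, A (u * t).
Proof.
move=> u0 [M [_ HM]]; exists (M / u); split; first exact: num_real.
by move=> t; rewrite ltr_pdivrMr// mulrC; exact: HM.
Qed.

Lemma cvg_pinfty_scale (u l : R) (phi : R -> R) : 0 < u ->
  phi t @[t --> +oo] --> l -> phi (u * t) @[t --> +oo] --> l.
Proof. by move=> u0 h A /h; exact: near_pinfty_scale. Qed.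

Lemma cvg_near_eq (f g : R -> R) (l : R) : (\forall t \near +oo, f t = g t) ->
  f t @[t --> +oo] --> l -> g t @[t --> +oo] --> l.
Proof.
move=> fg /cvgrPdist_lt fl; apply/cvgrPdist_lt => e e0.
by apply: filterS2 fg (fl e e0) => t ->.
Qed.

Lemma asymp_equiv_neq0 f g : asymp_equiv f g -> \forall t \near +oo, g t != 0.
Proof.
move=> /cvgrPdist_lt /(_ 1 ltr01); apply: filterS => t.
by apply: contraTneq => ->; rewrite invr0 mulr0 subr0 normr1 ltxx.
Qed.

Lemma doubling_ind (Q : R -> Prop) (s0 : R) : 0 < s0 ->
  (forall s, s0 <= s < 2 * s0 -> Q s) -> (forall s, s0 <= s -> Q s -> Q (2 * s)) ->
  forall s, s0 <= s -> Q s.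
Proof.
move=> s0_gt0 base step.
suff H : forall n s, s0 <= s < 2 ^+ n * s0 -> Q s.
  move=> s s0s; apply: (H (Num.Def.archi_bound (s / s0))).
  by rewrite s0s -ltr_pdivrMr// upper_nthrootP.
elim=> [|n IH] s; first by rewrite expr0 mul1r => /andP[h1 h2]; lra.
move=> /andP[s0s sn]; case: (ltP s (2 * s0)) => h; first by apply: base; rewrite s0s.
have -> : s = 2 * (s / 2) by field.
apply: step; first by lra.
apply: IH; apply/andP; split; first by lra.
by rewrite exprS -mulrA in sn; lra.
Qed.



Lemma is_derive_ndecr (f df : R -> R) (a b : R) : a <= b ->
  (forall x, a <= x <= b -> is_derive x 1 f (df x)) ->
  (forall x, a <= x <= b -> 0 <= df x) -> f a <= f b.
Proof.
move=> ab fdf df0.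
have fd x : x \in `]a, b[ -> derivable f x 1.
  by rewrite in_itv/= => /andP[/ltW h1 /ltW h2]; have [] := fdf x; rewrite ?h1.
apply: (ger0_derive1_ndecr fd) => //.
- move=> x; rewrite in_itv/= => /andP[/ltW h1 /ltW h2].
  have h : a <= x <= b by rewrite h1.
  by rewrite derive1E (@derive_val _ _ _ _ _ _ _ (fdf x h)) df0.
- apply: derivable_within_continuous => x; rewrite in_itv/= => h.
  by have [] := fdf x h.
Qed.

Lemma gt0_powRD (a r s : R) : 0 < a -> a `^ (r + s) = a `^ r * a `^ s.
Proof. by move=> a0; rewrite powRD// (gt_eqF a0) implybT. Qed.

Lemma powR_gt1 (a x : R) : 1 < a -> 0 < x -> 1 < a `^ x.
Proof.
move=> a1 x0; rewrite ltNge; apply/negP => /ln_le0.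
by rewrite ln_powR leNgt mulr_gt0// ln_gt0.
Qed.

(** The power a^p has slope [p] at 1, so just to the right it stays below any steeper line. This
    supplies the step ratio [l] of the geometric iterations behind Karamata's limit. *)
Lemma powR_lt_tangent (p c : R) : p < c -> exists2 l, 1 < l & l `^ p - 1 < c * (l - 1).
Proof.
move=> pc.
have [dv] := @is_derive1_powR R p _ ltr01; rewrite powR1 mulr1 => dval.
have : h^-1 *: (((fun a : R => a `^ p) \o shift 1) (h *: 1) - 1 `^ p) @[h --> 0^'] --> p.
  by rewrite -[X in _ --> X]dval; exact: dv.
move=> /cvgr_lt/(_ _ pc)/nbhs_ballP[e /= e0 He].
have e20 : 0 < e / 2 by rewrite divr_gt0.
exists (1 + e / 2); first by rewrite ltrDl.
have /= := He (e / 2) _ _; rewrite powR1 => h.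
have {}h := h _ _.
rewrite (_ : 1 + e / 2 - 1 = e / 2); last by ring.
rewrite -ltr_pdivrMr// mulrC.
have -> : 1 + e / 2 = (e / 2) *: 1 + 1 by rewrite /GRing.scale/= mulr1 addrC.
apply: h; last by rewrite gt_eqF.
by rewrite /ball/= sub0r normrN gtr0_norm//; lra.
Qed.

Lemma geometric_unbounded (l M : R) : 1 < l -> exists n, M < l ^+ n.
Proof.
move=> l1; pose n := Num.Def.archi_bound (`|M| / (l - 1)).
have l0 : 0 < l - 1 by rewrite subr_gt0.
have bern k : 1 + k%:R * (l - 1) <= l ^+ k.
  elim: k => [|k IH]; first by rewrite mul0r addr0 expr0.
  rewrite exprS -natr1; have : 0 <= (l - 1) * (l ^+ k - 1).
    by rewrite mulr_ge0 ?subr_ge0 ?exprn_ege1// ltW.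
  by have := ler_wpM2r (ltW l0) (lexx (k%:R : R)); lra.
exists n; apply: lt_le_trans (bern n).
have : `|M| < n%:R * (l - 1) by rewrite -ltr_pdivrMr// archi_boundP// divr_ge0// ltW.
by have := ler_norm M; lra.
Qed.

End regular_variation.

(** * Uniform comparison of density values over bounded ratios *)

Section regularly_varying_density.
Context {R : realType}.

(* By Baire's theorem one of the closed sets
   [{x | forall t >= n, f (e^x t) <= 2 e^(-rho x) f t}] contains an interval. *)
Lemma regularly_varying_locally_bounded (rho : R) (f : R -> R) :
  continuous f -> (forall x, 0 <= f x) -> regularly_varying rho f ->
  exists r K S : R, [/\ 0 < r, 0 < K, 0 < S &
    forall s z, S <= s -> `|z| < r -> f (expR z * s) <= K * f s].
Proof.
move=> cf f0 rv.
have fpos : \forall t \near +oo, 0 < f t.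
  have := asymp_equiv_neq0 (rv 1 ltr01); apply: filterS => t.
  by rewrite mulf_eq0 negb_or => /andP[_ h]; rewrite lt_neqAle eq_sym h f0.
have ev u : 0 < u -> \forall t \near +oo, f (u * t) <= 2 * u `^ (- rho) * f t.
  move=> u0; have := rv u u0 => /cvgr_lt/(_ 2 (ltr1n _ 2)).
  apply: filter_app; apply: filterS fpos => t ft.
  rewrite ltr_pdivrMr ?mulr_gt0// ?powR_gt0// mulrA => /ltW//.
pose E (n : nat) := [set x : R | forall t, n%:R <= t ->
  f (expR x * t) <= 2 * expR (x * - rho) * f t].
have [n [x0 [r [r0 Er]]]] : exists n x0 r, 0 < r /\ forall x, `|x - x0| < r -> E n x.
  apply: contrapT => noE.
  have cE n : closed (E n).
    rewrite (_ : E n = \bigcap_(t in [set t : R | n%:R <= t])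
      [set x | f (expR x * t) - 2 * expR (x * - rho) * f t <= 0]); last first.
      apply/seteqP; split=> x h t nt /=.
        by have := h t nt; rewrite subr_le0.
      by have := h t nt; rewrite /= subr_le0.
    apply: closed_bigI => t _.
    apply: ((continuous_closedP (fun x => f (expR x * t) - 2 * expR (x * - rho) * f t)).1 _
      [set y | y <= 0] (@closed_le R 0)).
    move=> x.
    apply: cvgB.
      apply: (@continuous_comp _ _ _ (fun x => expR x * t) f) => //; last exact: cf.
      by apply: cvgMl; exact: continuous_expR.
    apply: cvgMl; apply: cvgMr.
    apply: continuous_cvg; first exact: continuous_expR.
    by apply: cvgMl; exact: cvg_id.
  have odE n : open (~` E n) /\ dense (~` E n).
    split; first exact: closed_openC.
    move=> O [x Ox] oO; apply: contrapT => OE; apply: noE.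
    have /nbhs_ballP[r /= r0 Br] : nbhs x O by exact: open_nbhs_nbhs.
    exists n, x, r; split=> // y xy; apply: contrapT => Ey.
    by apply: OE; exists y; split => //; apply: Br; rewrite /ball/= distrC.
  have [|//|x [_ Ex]] := Baire odE (O := setT); first by exists 0.
    exact: openT.
  have [M [_ HM]] := ev _ (expR_gt0 x).
  apply: (Ex (Num.Def.archi_bound `|M|)) => // t Mt; rewrite expRM; apply: HM.
  by rewrite (lt_le_trans _ Mt)// (le_lt_trans (ler_norm _))// archi_boundP.
(* The interval found is centred at [x0] instead of 0. Passing through the point e^(-x0) s recentres
   it at the price of one pointwise comparison; [K] bounds 2 e^(-rho x) for all [x] within [r] of
   [x0]. *)
have [M1 [_ HM1]] := ev _ (expR_gt0 (- x0)).
pose K := 2 * expR (`|rho| * (`|x0| + r)).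
exists r, (K * (2 * expR (- x0) `^ (- rho))), (Num.max 1 (Num.max (M1 + 1) (n%:R * expR x0))).
split => //; first by rewrite !mulr_gt0// ?expR_gt0// powR_gt0// expR_gt0.
  by rewrite lt_max ltr01.
move=> s z; rewrite !ge_max => /and3P[s1 sM sn] zr.
have h1 : f (expR (- x0) * s) <= 2 * expR (- x0) `^ (- rho) * f s.
  by apply: HM1; lra.
have /Er/(_ (expR (- x0) * s)) : `|x0 + z - x0| < r by rewrite addrAC subrr add0r.
have -> : expR (x0 + z) * (expR (- x0) * s) = expR z * s.
  by rewrite mulrA -expRD; congr (expR _ * _); ring.
move=> h2.
have ns : n%:R <= expR (- x0) * s by rewrite expRN mulrC ler_pdivlMr// expR_gt0.
apply: le_trans (h2 ns) _.
have h3 : 2 * expR ((x0 + z) * - rho) <= K.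
  rewrite ler_pM2l// ler_expR.
  rewrite (le_trans (ler_norm _))// normrM normrN mulrC ler_wpM2l//.
  by rewrite (le_trans (ler_normD _ _))// lerD2l ltW.
rewrite -[leRHS]mulrA; apply: le_trans (ler_wpM2r _ h3) _; first exact: f0.
by rewrite ler_wpM2l// mulr_ge0// expR_ge0.
Qed.

(** On the logarithmic scale a ratio up to 4 is reached in [k] steps shorter than [r], each costing
    a factor [K]. Ratio 4 covers any two points of [t/2, 2t]. *)
Lemma regularly_varying_bounded_ratio (rho : R) (f : R -> R) :
  continuous f -> (forall x, 0 <= f x) -> regularly_varying rho f ->
  exists K S : R, [/\ 0 < K, 0 < S &
    forall s u, S <= s -> s / 4 <= u <= 4 * s -> f u <= K * f s].
Proof.
move=> cf f0 rv.
have [r [K [S [r0 K0 S0 H]]]] := regularly_varying_locally_bounded cf f0 rv.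
pose q := r / 2; have q0 : 0 < q by rewrite divr_gt0.
(* The threshold S e^(kq) leaves room for [k] downward steps within the range [S <= s]; [q = r / 2]
   makes each step strictly shorter than [r]. *)
have iter (k : nat) s z : S * expR (k%:R * q) <= s -> `|z| <= k%:R * q ->
    f (expR z * s) <= K ^+ k * f s.
  elim: k s z => [|k IH] s z.
    by rewrite !mul0r normr_le0 => _ /eqP ->; rewrite expR0 expr0 !mul1r.
  move=> Ss zk; pose z1 := z / k.+1%:R.
  have z1q : `|z1| <= q by rewrite normrM normfV (ger0_norm (ler0n _ _)) ler_pdivrMr ?ltr0n// mulrC.
  have z2q : `|z - z1| <= k%:R * q.
    have -> : z - z1 = k%:R * z1.
      have {1}-> : z = k.+1%:R * z1 by rewrite mulrCA divff ?mulr1// pnatr_eq0.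
      by rewrite -natr1; ring.
    by rewrite normrM (ger0_norm (ler0n _ _)) ler_wpM2l.
  have Sk : S * expR (k%:R * q) <= s.
    apply: le_trans Ss; rewrite ler_pM2l// ler_expR ler_pM2r// ler_nat//.
  have -> : expR z * s = expR z1 * (expR (z - z1) * s).
    by rewrite mulrA -expRD; congr (expR _ * _); ring.
  rewrite exprS -mulrA; apply: le_trans (_ : K * f (expR (z - z1) * s) <= _).
    apply: H; last by rewrite (le_lt_trans z1q)// /q; lra.
    apply: le_trans (_ : expR (- (k%:R * q)) * (S * expR (k%:R * q)) <= _).
      by rewrite mulrCA -expRD addNr expR0 mulr1.
    rewrite ler_pM ?expR_ge0//; first by rewrite mulr_ge0 ?expR_ge0// ltW.
    by rewrite ler_expR lerNl (le_trans _ z2q)// -normrN ler_norm.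
  by rewrite ler_pM2l//; exact: IH.
pose k := Num.Def.archi_bound (ln 4 / q).
have kq : ln 4 <= k%:R * q.
  by rewrite -ler_pdivrMr// ltW// archi_boundP// divr_ge0 ?ln_ge0 ?ler1n// ltW.
exists (K ^+ k), (S * expR (k%:R * q)); split.
- by rewrite exprn_gt0.
- by rewrite mulr_gt0// expR_gt0.
move=> s u Ss /andP[su us].
have s0 : 0 < s by rewrite (lt_le_trans _ Ss)// mulr_gt0// expR_gt0.
have u0 : 0 < u by lra.
have us0 : 0 < u / s by rewrite divr_gt0.
have -> : u = expR (ln (u / s)) * s by rewrite lnK ?posrE// divfK// gt_eqF.
apply: iter => //; rewrite (le_trans _ kq)// ler_norml; apply/andP; split.
  rewrite -lnV ?posrE// ler_ln ?posrE ?invr_gt0//.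
  by rewrite ler_pdivlMr// mulrC.
by rewrite ler_ln ?posrE// ler_pdivrMr.
Qed.

End regularly_varying_density.

(** * Doubling: growth of s^2 F(s) when alpha < 2 *)

Section tail_asymptotics.
Context {R : realType}.
Variables (F H : R -> R) (alpha : R).
Hypothesis F_gt0 : forall t, 0 < F t.
Hypothesis F_nonincr : {homo F : s t / s <= t >-> t <= s}.
Hypothesis F_ratio : forall u, 0 < u -> F (u * t) / F t @[t --> +oo] --> u `^ (- alpha).

Lemma F_ratio_le u r : 0 < u -> u `^ (- alpha) < r -> \forall t \near +oo, F (u * t) <= r * F t.
Proof.
move=> u0 ur; have /cvgr_le/(_ _ ur) := F_ratio u0.
by apply: filterS => t; rewrite ler_pdivrMr.
Qed.

Lemma F_ratio_ge u r : 0 < u -> r < u `^ (- alpha) -> \forall t \near +oo, r * F t <= F (u * t).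
Proof.
move=> u0 ur; have /cvgr_ge/(_ _ ur) := F_ratio u0.
by apply: filterS => t; rewrite ler_pdivlMr.
Qed.

(** The size of truncated second moments at level [t]. Multiplied by the Lipschitz rate F(t)/t it
    becomes t F(t)^2, the scale of the whole comparison. *)
Definition sqF (t : R) := t ^+ 2 * F t.

Section doubling.
Hypothesis alpha_lt2 : alpha < 2.

Lemma sqF_doubling : exists rho s0 : R, [/\ 1 < rho, 0 < s0 &
  forall s, s0 <= s -> rho * sqF s <= sqF (2 * s)].
Proof.
have p1 : 1 < 4 * 2 `^ (- alpha) :> R.
  rewrite (_ : 4 = 2 `^ 2); last by rewrite powR_mulrn// expr2; ring.
  rewrite -powRD; last by rewrite pnatr_eq0 implybT.
  by rewrite powR_gt1 ?ltr1n// subr_gt0.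
(* The midpoint of 1/4 and 2^(-alpha): then 4r > 1, while r stays below the limit of F(2s)/F(s). *)
pose r := (1 + 4 * 2 `^ (- alpha)) / 8 : R.
have r2 : r < 2 `^ (- alpha) by rewrite /r; lra.
have [M [_ HM]] := F_ratio_ge (ltr0n _ 2) r2.
exists (4 * r), (Num.max 1 (M + 1)); split; first by rewrite /r; lra.
  by rewrite lt_max ltr01.
move=> s; rewrite ge_max => /andP[s1 sM].
have h : r * F s <= F (2 * s) by apply: HM; lra.
have : 0 <= 4 * s ^+ 2 * (F (2 * s) - r * F s) by rewrite mulr_ge0 ?subr_ge0// mulr_ge0// sqr_ge0.
by rewrite /sqF; lra.
Qed.

(* Telescoping along [s, 2 s, 4 s, ...]: the increments [eta * sqF] form a
   geometrically growing sequence. *)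
Lemma doubling_bound : exists A S : R, [/\ 0 < A, 0 < S &
  forall (N : R -> R) (eta N0 s0 smax : R), 0 <= eta -> 0 <= N0 -> S <= s0 ->
  (forall s, s0 <= s < 2 * s0 -> s <= smax -> N s <= N0) ->
  (forall s, s0 <= s -> 2 * s <= smax -> N (2 * s) <= N s + eta * sqF s) ->
  forall s, s0 <= s -> s <= smax -> N s <= A * eta * sqF s + N0].
Proof.
have [rho [S [rho1 S0 HS]]] := sqF_doubling.
(* This [A] solves A + 1 = A rho, so the bound at [s] plus one increment is dominated by the bound
   at [2 * s]. *)
exists (rho - 1)^-1, S; split => //; first by rewrite invr_gt0 subr_gt0.
move=> N eta N0 s0 smax eta0 N00 Ss0 base step.
have s00 : 0 < s0 by exact: lt_le_trans Ss0.
have U0 s : s0 <= s -> 0 < sqF s.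
  by move=> s0s; rewrite mulr_gt0// exprn_gt0// (lt_le_trans s00).
apply: (doubling_ind s00) => [s s0s ssm|s s0s IH ssm].
  rewrite (le_trans (base _ s0s ssm))// lerDr; apply: mulr_ge0.
    by rewrite mulr_ge0// invr_ge0 subr_ge0 ltW.
  by apply/ltW/U0; case/andP: s0s.
have s2 : s <= smax by apply: le_trans ssm; have := lt_le_trans s00 s0s; lra.
apply: le_trans (step _ s0s ssm) _.
apply: le_trans (lerD (IH s2) (lexx _)) _.
have h := HS s (le_trans Ss0 s0s).
have e : (rho - 1)^-1 * eta * sqF s + N0 + eta * sqF s = (rho - 1)^-1 * eta * (rho * sqF s) + N0.
  by field; rewrite subr_eq0 gt_eqF.
by rewrite e lerD2r ler_wpM2l// mulr_ge0// invr_ge0 subr_ge0 ltW.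
Qed.

(** Each doubling adds at least the fixed amount [(rho - 1) * c], where [c] bounds [sqF] from below
    on [S, +oo[. *)
Lemma sqF_unbounded M : \forall t \near +oo, M <= sqF t.
Proof.
have [rho [S [rho1 S0 HS]]] := sqF_doubling.
pose c := S ^+ 2 * F (2 * S).
have c0 : 0 < c by rewrite mulr_gt0// exprn_gt0.
have low : forall s, S <= s -> c <= sqF s.
  apply: (doubling_ind S0) => s => [/andP[h1 h2]|h1 h2].
    apply: ler_pM; [by rewrite exprn_ge0// ltW|exact: ltW| |by apply: F_nonincr; exact: ltW].
    by rewrite ler_pXn2r// nnegrE ltW// (lt_le_trans S0).
  apply: le_trans h2 _; apply: le_trans (HS _ h1).
  by rewrite ler_peMl ?(ltW rho1)// ltW// mulr_gt0// exprn_gt0// (lt_le_trans S0).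
have grow n : forall s, 2 ^+ n * S <= s -> c * (1 + n%:R * (rho - 1)) <= sqF s.
  elim: n => [|n IH] s; first by rewrite expr0 !mul1r mul0r addr0 mulr1; exact: low.
  rewrite exprS -mulrA => ns.
  have h : 2 ^+ n * S <= s / 2 by lra.
  have Ss : S <= s / 2 by rewrite (le_trans _ h)// ler_peMl ?exprn_ege1 ?ler1n// ltW.
  have := HS _ Ss; rewrite (_ : 2 * (s / 2) = s); last by field.
  apply: le_trans; have h1 := IH _ h; have h2 := low _ Ss.
  rewrite -natr1; apply: le_trans (_ : sqF (s / 2) + (rho - 1) * c <= _).
    by apply: le_trans (lerD h1 (lexx _)); lra.
  have : (rho - 1) * c <= (rho - 1) * sqF (s / 2) by rewrite ler_pM2l// subr_gt0.
  lra.
pose n := Num.Def.archi_bound (`|M| / (c * (rho - 1))).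
have hn : `|M| < n%:R * (c * (rho - 1)).
  by rewrite -ltr_pdivrMr ?archi_boundP ?divr_ge0// ?mulr_gt0 ?subr_gt0// ltW// mulr_gt0// subr_gt0.
apply: filterS (nbhs_pinfty_ge (num_real (2 ^+ n * S))) => t /grow.
apply: le_trans; have := ler_norm M; lra.
Qed.

End doubling.

End tail_asymptotics.

(** * Karamata's limit from the convexity of H *)

Section karamata.
Context {R : realType}.
Variables (F H : R -> R) (alpha : R).
Hypothesis F_gt0 : forall t, 0 < F t.
Hypothesis F_ratio : forall u, 0 < u -> F (u * t) / F t @[t --> +oo] --> u `^ (- alpha).
Hypothesis alpha_gt1 : 1 < alpha.
Hypothesis H_slope : forall s t, s <= t -> (t - s) * F t <= H s - H t <= (t - s) * F s.
Hypothesis H_cvg0 : H t @[t --> +oo] --> 0.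
Hypothesis H_ge0 : forall t, 0 <= H t.

Lemma powR_mulB1 (l : R) : 1 < l -> l `^ (1 - alpha) = l * l `^ (- alpha).
Proof.
move=> l1; have l0 : 0 < l by exact: lt_trans l1.
by rewrite gt0_powRD// powRr1// ltW.
Qed.

Let near_geometric (l : R) (A : set R) : 1 < l -> (\forall t \near +oo, A t) ->
  forall t, 0 < t -> exists n, A (l ^+ n * t).
Proof.
move=> l1 [M [_ HM]] t t0; have [n Hn] := geometric_unbounded (M / t) l1.
by exists n; apply: HM; rewrite -ltr_pdivrMr.
Qed.

Let iterate_geometric (Psi : R -> R) (l M t : R) : 1 < l -> 0 < t -> M < t ->
  (forall s, M < s -> 0 < s -> Psi s <= Psi (l * s)) -> forall n, Psi t <= Psi (l ^+ n * t).
Proof.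
move=> l1 t0 Mt step; elim=> [|n IH]; first by rewrite expr0 mul1r.
apply: le_trans IH _; rewrite exprS -mulrA; apply: step.
  by rewrite (lt_le_trans Mt)// ler_peMl ?exprn_ege1// ltW.
by rewrite mulr_gt0// exprn_gt0// (lt_trans _ l1).
Qed.

(** For large [t] the excess [H t - K * (t * F t)] does not decrease along [t], [l * t],
    [l ^+ 2 * t] and so on. It is at most [H], which tends to 0, so it cannot be positive. *)
Lemma karamata_le K : (alpha - 1)^-1 < K -> \forall t \near +oo, H t <= K * (t * F t).
Proof.
move=> aK; have a1 : 0 < alpha - 1 by rewrite subr_gt0.
have K0 : 0 < K by apply: lt_trans aK; rewrite invr_gt0.
have [l l1] : exists2 l, 1 < l & l `^ (1 - alpha) - 1 < - K^-1 * (l - 1).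
  apply: powR_lt_tangent; rewrite ltrNr opprB.
  by rewrite -(invrK (alpha - 1)) ltf_pV2 ?posrE ?invr_gt0.
rewrite powR_mulB1// => hl.
have l0 : 0 < l by exact: lt_trans l1.
(* With F(ls) <= r F(s), this [r] makes the decrease K (1 - l r) s F(s) of the second term match the
   bound (l - 1) s F(s) on H(s) - H(ls). *)
pose r := (1 - (l - 1) / K) / l.
have lr : l `^ (- alpha) < r.
  by rewrite ltr_pdivlMr// mulrC; move: hl; rewrite mulNr (mulrC K^-1); lra.
have [M [_ HM]] := F_ratio_le F_gt0 F_ratio l0 lr.
have Kr : K * (1 - l * r) = l - 1 by rewrite /r; field; rewrite !gt_eqF.
pose Psi t := H t - K * (t * F t).
exists (Num.max M 1); split; first exact: num_real.
move=> t; rewrite gt_max => /andP[Mt t1].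
have t0 : 0 < t by exact: lt_trans t1.
rewrite -subr_le0 leNgt; apply/negP => Psi0.
have [n] := near_geometric l1 (cvgr_lt _ H_cvg0 _ Psi0) t0.
apply/negP; rewrite -leNgt.
apply: le_trans (_ : Psi (l ^+ n * t) <= _); last first.
  rewrite lerBlDr lerDl mulr_ge0 ?(ltW K0)// mulr_ge0 ?(ltW (F_gt0 _))//.
  by rewrite mulr_ge0 ?exprn_ge0// ltW.
apply: (@iterate_geometric Psi l M t) => // s Ms s0.
have /andP[_ h1] : (l * s - s) * F (l * s) <= H s - H (l * s) <= (l * s - s) * F s.
  by apply: H_slope; rewrite ler_peMl// ltW.
have h2 : K * l * s * F (l * s) <= K * l * s * (r * F s).
  by rewrite ler_wpM2l ?HM// !mulr_ge0// ltW.
have h3 : (l * s - s) * F s = K * (1 - l * r) * (s * F s) by rewrite Kr; ring.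
rewrite /Psi; lra.
Qed.

Lemma mulF_le t : t * F t <= 2 * H (t / 2).
Proof.
have [t0|t0] := leP 0 t; last first.
  apply: le_trans (_ : 0 <= _); last by rewrite mulr_ge0.
  by apply: mulr_le0_ge0; exact: ltW.
have /andP[h _] : (t - t / 2) * F t <= H (t / 2) - H t <= (t - t / 2) * F (t / 2).
  by apply: H_slope; lra.
have := H_ge0 t; lra.
Qed.

(** The mirror iteration, for [K * (t * F t) - H t]. At a point u this is at most 2 K H(u/2) by
    [mulF_le], which tends to 0; hence [near_geometric] is started from [t / 2]. *)
Lemma karamata_ge K : 0 < K -> K < (alpha - 1)^-1 -> \forall t \near +oo, K * (t * F t) <= H t.
Proof.
move=> K0 aK; have a1 : 0 < alpha - 1 by rewrite subr_gt0.
have [l l1 hl] : exists2 l, 1 < l & l `^ alpha - 1 < (1 + K^-1) * (l - 1).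
  apply: powR_lt_tangent; rewrite -ltrBlDl.
  by rewrite -(invrK (alpha - 1)) ltf_pV2 ?posrE ?invr_gt0.
have l0 : 0 < l by exact: lt_trans l1.
have d0 : 0 < l - 1 + K * l by rewrite addr_gt0 ?subr_gt0// mulr_gt0.
pose r := K / (l - 1 + K * l).
have lr : r < l `^ (- alpha).
  rewrite powRN ltr_pdivrMr// ltr_pdivlMl ?powR_gt0// .
  have : K * (l `^ alpha - 1) < K * ((1 + K^-1) * (l - 1)) by rewrite ltr_pM2l.
  rewrite (_ : K * ((1 + K^-1) * (l - 1)) = (K + 1) * (l - 1)); first by lra.
  by field; rewrite gt_eqF.
have [M [_ HM]] := F_ratio_ge F_gt0 F_ratio l0 lr.
have Kr : (l - 1 + K * l) * r = K by rewrite /r; field; rewrite !gt_eqF.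
pose Psi t := K * (t * F t) - H t.
exists (Num.max M 1); split; first exact: num_real.
move=> t; rewrite gt_max => /andP[Mt t1].
have t0 : 0 < t by exact: lt_trans t1.
rewrite -subr_le0 leNgt; apply/negP => Psi0.
have P0 : 0 < (K * (t * F t) - H t) / (2 * K) by rewrite divr_gt0// mulr_gt0.
have t20 : 0 < t / 2 by rewrite divr_gt0.
have [n hn] := near_geometric l1 (cvgr_lt _ H_cvg0 _ P0) t20.
have : Psi t <= Psi (l ^+ n * t).
  apply: (@iterate_geometric Psi l M t) => // s Ms s0.
  have /andP[h1 _] : (l * s - s) * F (l * s) <= H s - H (l * s) <= (l * s - s) * F s.
    by apply: H_slope; rewrite ler_peMl// ltW.
  have h2 : (l - 1 + K * l) * s * (r * F s) <= (l - 1 + K * l) * s * F (l * s).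
    by rewrite ler_wpM2l ?HM// !mulr_ge0// ltW.
  have h3 : (l - 1 + K * l) * s * (r * F s) = K * (s * F s) by rewrite -{2}Kr; ring.
  rewrite /Psi; lra.
apply/negP; rewrite -ltNge.
have h1 : K * (l ^+ n * t * F (l ^+ n * t)) <= K * (2 * H (l ^+ n * t / 2)).
  by rewrite ler_pM2l// mulF_le.
have h2 : (2 * K) * H (l ^+ n * t / 2) < K * (t * F t) - H t.
  by rewrite mulrC -ltr_pdivlMr ?mulr_gt0// -mulrA.
rewrite /Psi; have := H_ge0 (l ^+ n * t); lra.
Qed.

Lemma karamata : H t / (t * F t) @[t --> +oo] --> (alpha - 1)^-1.
Proof.
have a0 : 0 < (alpha - 1)^-1 by rewrite invr_gt0 subr_gt0.
apply/cvgrPdist_le => e e0.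
have near0 : \forall t \near +oo, 0 < t * F t.
  by apply: filterS (nbhs_pinfty_gt (num_real 0)) => t t0; exact: mulr_gt0.
have lo : \forall t \near +oo, ((alpha - 1)^-1 - e) * (t * F t) <= H t.
  have [h|h] := leP ((alpha - 1)^-1 - e) 0; last first.
    by apply: karamata_ge => //; rewrite ltrBlDr ltrDl.
  by apply: filterS near0 => t tF; rewrite (le_trans _ (H_ge0 t))// mulr_le0_ge0// ltW.
have hi : \forall t \near +oo, H t <= ((alpha - 1)^-1 + e) * (t * F t).
  by apply: karamata_le; rewrite ltrDl.
near=> t; have tF : 0 < t * F t by near: t.
rewrite ler_distlC ler_pdivlMr// ler_pdivrMr//.
by apply/andP; split; [near: t; exact: lo|near: t; exact: hi].
Unshelve. all: end_near. Qed.

Lemma H_ratio u : 0 < u ->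
  H (u * t) / (t * F t) @[t --> +oo] --> u `^ (1 - alpha) / (alpha - 1).
Proof.
move=> u0.
rewrite gt0_powRD// powRr1 ?ltW//.
have k := @cvg_pinfty_scale _ u _ (fun t => H t / (t * F t)) u0 karamata.
have h0 : u * (F (u * t) / F t) @[t --> +oo] --> u * u `^ (- alpha).
  by apply: cvgMr; exact: F_ratio.
have h1 := cvgM h0 k.
apply: (@cvg_near_eq _ _ _ _ _ (h1 _)); apply: filterS (nbhs_pinfty_gt (num_real 0)) => t t0 /=.
by have := F_gt0 t; have := F_gt0 (u * t) => ? ?; field; rewrite !gt_eqF.
Qed.

End karamata.

(** * One-sided asymptotic bounds and Riemann-Stieltjes sums *)

Section limsup.
Context {R : realType}.
Implicit Types (phi psi : R -> R) (c : R).

Definition limsup_le phi c := forall e, 0 < e -> \forall t \near +oo, phi t <= c + e.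

Lemma cvg_limsup_le phi c : phi t @[t --> +oo] --> c -> limsup_le phi c.
Proof. by move=> h e e0; apply: (cvgr_le _ h); rewrite ltrDl. Qed.

Lemma limsup_leD phi psi c1 c2 : limsup_le phi c1 -> limsup_le psi c2 ->
  limsup_le (fun t => phi t + psi t) (c1 + c2).
Proof.
move=> h1 h2 e e0; have e20 : 0 < e / 2 by rewrite divr_gt0.
by apply: filterS2 (h1 _ e20) (h2 _ e20) => t; lra.
Qed.

Lemma limsup_le_near phi psi c : (\forall t \near +oo, phi t <= psi t) ->
  limsup_le psi c -> limsup_le phi c.
Proof. by move=> h1 h2 e e0; apply: filterS2 h1 (h2 _ e0) => t; exact: le_trans. Qed.

Lemma limsup_le_trans phi c1 c2 : c1 <= c2 -> limsup_le phi c1 -> limsup_le phi c2.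
Proof. by move=> c12 h e e0; apply: filterS (h e e0) => t; lra. Qed.

Lemma limsup_lt0 phi c : c < 0 -> limsup_le phi c -> \forall t \near +oo, phi t < 0.
Proof.
move=> c0 h; have e0 : 0 < - c / 2 by lra.
by apply: filterS (h _ e0) => t; lra.
Qed.

(* Bounds a Riemann-Stieltjes sum of [g d(-x^(-alpha))] by an antiderivative:
   the cells of a fine partition of [a, b] are summed by induction. *)
Lemma limsup_stieltjes (alpha a b L : R) (g Phi dPhi : R -> R) (G : R -> R -> R)
    (J : R -> R -> R -> R) : 0 <= alpha -> 0 < a -> a < b -> 0 <= L ->
  (forall u v w t, a <= u -> u <= v -> v <= w -> w <= b -> 0 < t ->
     J u w t = J u v t + J v w t) ->
  (forall u v, a <= u -> u <= v -> v <= b ->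
     limsup_le (J u v) (G u v * (u `^ (- alpha) - v `^ (- alpha)))) ->
  (forall u x v, a <= u -> u <= x -> x <= v -> v <= b -> G u v <= g x + L * (v - u)) ->
  (forall x, a <= x <= b -> is_derive x 1 Phi (dPhi x)) ->
  (forall x, a <= x <= b -> g x * (alpha * x `^ (- alpha - 1)) <= dPhi x) ->
  limsup_le (J a b) (Phi b - Phi a).
Proof.
move=> alpha0 a0 ab L0 Jadd Jcell Gg dP gP e e0.
pose q x : R := x `^ (- alpha).
have qba : q b <= q a.
  have b0 : 0 < b by exact: lt_trans ab.
  rewrite /q !powRN lef_pV2 ?posrE ?powR_gt0//.
  by apply: ge0_ler_powR; rewrite // ?nnegrE ltW.
(* The mesh is fixed before [t] grows, so only finitely many cell limits are used; the variation
   within cells costs at most L h (q(a) - q(b)) < e/2. *)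
pose n := (Num.Def.archi_bound (L * (b - a) * (q a - q b) * 2 / e)).+1.
pose h := (b - a) / n%:R.
have n0 : 0 < n%:R :> R by rewrite ltr0n.
have h0 : 0 < h by rewrite divr_gt0// subr_gt0.
have hn : n%:R * h = b - a by rewrite /h mulrCA divff ?mulr1// gt_eqF.
have Lh : L * h * (q a - q b) < e / 2.
  have : L * (b - a) * (q a - q b) * 2 / e < n%:R.
    apply: lt_trans (archi_boundP _) _; last by rewrite ltr_nat.
    by rewrite divr_ge0 ?(ltW e0)// !mulr_ge0// subr_ge0 ?(ltW ab).
  rewrite ltr_pdivrMr// -hn => H.
  rewrite -(ltr_pM2l n0); lra.
have cell u v : a <= u -> u <= v -> v <= b -> v - u <= h ->
    G u v * (q u - q v) <= Phi v - Phi u + L * h * (q u - q v).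
  move=> au uv vb vuh.
  (* [c] lies below [g] on the cell and [q] has derivative -alpha x^(-alpha-1), so [Phi + c * q] is
     nondecreasing there. *)
  pose c := G u v - L * h.
  suff : Phi u + c * q u <= Phi v + c * q v by rewrite /c; lra.
  apply: (@is_derive_ndecr R (fun x => Phi x + c * q x)
    (fun x => dPhi x + c * (- alpha * x `^ (- alpha - 1)))) => // x /andP[ux xv].
    have x0 : 0 < x by lra.
    have axb : a <= x <= b by apply/andP; split; lra.
    have := dP x axb => D1; have D2 := @is_derive1_powR R (- alpha) x x0.
    by apply: is_deriveD.
  have x0 : 0 < x by lra.
  have axb : a <= x <= b by apply/andP; split; lra.
  have h1 := gP x axb.
  have h2 : c <= g x.
    have := Gg u x v au ux xv vb; have := ler_wpM2l L0 vuh; rewrite /c; lra.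
  have h3 : 0 <= alpha * x `^ (- alpha - 1) by rewrite mulr_ge0// powR_ge0.
  have := ler_wpM2r h3 h2; lra.
have step k : (k <= n)%N -> limsup_le (J a (a + k%:R * h))
    (Phi (a + k%:R * h) - Phi a + L * h * (q a - q (a + k%:R * h))).
  elim: k => [_|k IH kn].
    have := Jcell a a (lexx _) (lexx _) (ltW ab); rewrite subrr mulr0 mul0r addr0.
    by rewrite !subrr mulr0 addr0.
  have kb : a + k.+1%:R * h <= b.
    have : k.+1%:R * h <= n%:R * h by rewrite ler_pM2r// ler_nat.
    by rewrite hn; lra.
  have ak : a <= a + k%:R * h by rewrite lerDl mulr_ge0// ltW.
  have kk : a + k%:R * h <= a + k.+1%:R * h by rewrite -natr1; lra.
  apply: (@limsup_le_near _ (fun t => J a (a + k%:R * h) t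
     + J (a + k%:R * h) (a + k.+1%:R * h) t)).
    apply: filterS (nbhs_pinfty_gt (num_real 0)) => t t0.
    by rewrite -(Jadd a (a + k%:R * h) _ t).
  have hh := cell _ _ ak kk kb; apply: limsup_le_trans (limsup_leD (IH (ltnW kn)) (Jcell _ _ ak kk kb)).
  have : a + k.+1%:R * h - (a + k%:R * h) <= h by rewrite -natr1; lra.
  by move=> /hh; rewrite -/(q _) -/(q _); lra.
have e20 : 0 < e / 2 by rewrite divr_gt0.
have := step n (leqnn _); rewrite hn addrC subrK => /(_ _ e20).
by apply: filterS => t; lra.
Qed.

End limsup.

(** * Closed-form antiderivatives and their values *)

Section stieltjes_constants.
Context {R : realType}.
Variable alpha : R.
Hypothesis alpha_gt1 : 1 < alpha.
Hypothesis alpha_lt2 : alpha < 2.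

(** z^b - b z attains its minimum over z > 0 at z = 1. *)
Lemma bernoulli_powR_ge (b z : R) : 1 <= b -> 0 < z -> 1 + b * (z - 1) <= z `^ b.
Proof.
move=> b1 z0; have b0 : 0 <= b by exact: le_trans b1.
suff : 1 `^ b - b * 1 <= z `^ b - b * z by rewrite powR1; lra.
have dv (x : R) : 0 < x -> is_derive x 1 (fun y : R => y `^ b - b * y) (b * (x `^ (b - 1) - 1)).
  move=> x0; have D := @is_derive1_powR R b x x0.
  by apply: is_derive_eq; rewrite /GRing.scale/=; ring.
case: (leP 1 z) => z1.
  apply: (@is_derive_ndecr _ (fun x : R => x `^ b - b * x)
    (fun x => b * (x `^ (b - 1) - 1)) _ _ z1) => x /andP[x1 _].
    by apply: dv; lra.
  by rewrite mulr_ge0// subr_ge0 -[leLHS](powRr0 x) ler_powR// subr_ge0.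
have {}z1 := ltW z1; rewrite -lerN2.
apply: (@is_derive_ndecr _ (fun x : R => - (x `^ b - b * x))
  (fun x => - (b * (x `^ (b - 1) - 1))) _ _ z1) => x /andP[zx x1].
  by have D := dv x (lt_le_trans z0 zx); apply: is_deriveN.
have x01 : 0 < x <= 1 by rewrite x1 (lt_le_trans z0).
rewrite -mulrN opprB mulr_ge0// subr_ge0 -[leRHS](powRr0 x).
by apply: ger_powR => //; rewrite subr_ge0.
Qed.

(** The convex case with exponent 1/b, taken at the point z^b. *)
Lemma bernoulli_powR_le (b z : R) : 0 < b <= 1 -> 0 < z -> z `^ b <= 1 + b * (z - 1).
Proof.
move=> /andP[b0 b1] z0.
have := @bernoulli_powR_ge b^-1 (z `^ b) _ (powR_gt0 b z0).
rewrite invf_ge1// => /(_ b1).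
rewrite -powRrM divff ?gt_eqF// (powRr1 (ltW z0)) => h.
have : b * (1 + b^-1 * (z `^ b - 1)) <= b * z by rewrite ler_pM2l.
by rewrite mulrDr mulrA divff ?gt_eqF//; lra.
Qed.

(* With [w = v / (1 - v)] and [y = 1 / (1 - v)] the function
   [v^(1-alpha) (1-v)^(-alpha-1)] is [w^(1-alpha) y^(2 alpha - 2) y^2].  Replacing
   [y^(2 alpha - 2)] by its tangent at [y = 2] makes it integrable in closed form,
   with antiderivative [kap]; the error changes sign at [2 alpha - 2 = 1], which is
   where the threshold [3/2] comes from. *)
Definition kap (v : R) := 2 `^ (2 * alpha - 2) *
  ((v / (1 - v)) `^ (2 - alpha) + (alpha - 1) / (3 - alpha) * (v / (1 - v)) `^ (3 - alpha)).

Definition dkap (v : R) := 2 `^ (2 * alpha - 2) *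
  ((v / (1 - v)) `^ (1 - alpha) * (1 + (alpha - 1) * ((1 - v)^-1 - 2)) * (1 - v)^-1 ^+ 2).

Lemma is_derive_onem (v : R) : is_derive v 1 (fun x : R => 1 - x) (-1).
Proof. by apply: is_derive_eq; ring. Qed.

Lemma is_derive_odds (v : R) : v < 1 -> is_derive v 1 (fun x : R => x / (1 - x)) ((1 - v)^-1 ^+ 2).
Proof.
move=> v1; have v0 : 1 - v != 0 by rewrite gt_eqF// subr_gt0.
have D2 := is_derive_onem v.
have D := @is_deriveV R (fun x : R => 1 - x) v _ _ v0 D2.
by apply: is_derive_eq; rewrite /GRing.scale/=; field.
Qed.

Lemma is_derive_odds_powR (p v : R) : 0 < v < 1 ->
  is_derive v 1 (fun x : R => (x / (1 - x)) `^ p) (p * (v / (1 - v)) `^ (p - 1) * (1 - v)^-1 ^+ 2).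
Proof.
move=> /andP[v0 v1]; have w0 : 0 < v / (1 - v) by rewrite divr_gt0 ?subr_gt0.
have D := @is_derive1_powR R p _ w0.
exact: (@is_derive1_comp _ (fun y => y `^ p) (fun x => x / (1 - x)) v _ _ D (is_derive_odds v1)).
Qed.

Lemma is_derive_onem_powR (p v : R) : v < 1 ->
  is_derive v 1 (fun x : R => (1 - x) `^ p) (- (p * (1 - v) `^ (p - 1))).
Proof.
move=> v1; have v0 : 0 < 1 - v by rewrite subr_gt0.
have D := @is_derive1_powR R p _ v0.
have D2 := is_derive_onem v.
have := @is_derive1_comp _ (fun y => y `^ p) (fun x => 1 - x) v _ _ D D2.
by rewrite /GRing.scale/= mulrN1.
Qed.

Lemma is_derive_kap (v : R) : 0 < v < 1 -> is_derive v 1 kap (dkap v).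
Proof.
have a1 := alpha_gt1; have a2 := alpha_lt2.
move=> v01; have v0 : 1 - v != 0 by rewrite gt_eqF// subr_gt0; case/andP: v01.
have w0 : 0 < v / (1 - v) by case/andP: v01 => ? ?; rewrite divr_gt0 ?subr_gt0.
have D1 := is_derive_odds_powR (2 - alpha) v01.
have D2 := is_derive_odds_powR (3 - alpha) v01.
rewrite /kap; apply: is_derive_eq; rewrite /GRing.scale/= /dkap.
have -> : (v / (1 - v)) `^ (3 - alpha - 1) = (v / (1 - v)) `^ (1 - alpha) * (v / (1 - v)).
  by rewrite (_ : 3 - alpha - 1 = 1 - alpha + 1) ?gt0_powRD ?powRr1 ?ltW//; ring.
have -> : 2 - alpha - 1 = 1 - alpha by ring.
have c0 : 3 - alpha != 0 by rewrite gt_eqF//; lra.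
by field; rewrite ?v0 ?c0.
Qed.

Let odds_powR (v : R) : 0 < v < 1 -> v `^ (1 - alpha) * (1 - v) `^ (- alpha - 1) =
  (v / (1 - v)) `^ (1 - alpha) * (1 - v)^-1 `^ (2 * alpha - 2) * (1 - v)^-1 ^+ 2.
Proof.
have a1 := alpha_gt1; have a2 := alpha_lt2.
move=> /andP[v0 v1]; have y0 : 0 < 1 - v by rewrite subr_gt0.
rewrite powRM ?invr_ge0 ?ltW// -!powR_inv1 ?ltW// -!powRrM.
rewrite -powR_mulrn ?powR_ge0// -powRrM -!mulrA -!gt0_powRD//.
by congr (_ * _ `^ _); ring.
Qed.

(** The exponent 2 alpha - 2 lies in (0, 1], so the power is concave and below its tangent; with y =
    1/(1-v), the variable y/2 moves the point of tangency to 1. Convexity reverses the inequality in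
    [dkap_le]. *)
Lemma dkap_ge (v : R) : alpha <= 3 / 2 -> 0 < v < 1 ->
  v `^ (1 - alpha) * (1 - v) `^ (- alpha - 1) <= dkap v.
Proof.
have a1 := alpha_gt1; have a2 := alpha_lt2.
move=> a32 v01; rewrite odds_powR// /dkap [2 `^ _ * _]mulrA (mulrCA (2 `^ _)) ler_wpM2r ?sqr_ge0//.
rewrite ler_wpM2l ?powR_ge0//.
have y0 : 0 < (1 - v)^-1 by case/andP: v01 => ? ?; rewrite invr_gt0 subr_gt0.
have z0 : 0 < (1 - v)^-1 / 2 by rewrite divr_gt0.
have {1}-> : (1 - v)^-1 = 2 * ((1 - v)^-1 / 2) by rewrite mulrC divfK.
rewrite powRM ?(ltW z0)// ler_wpM2l ?powR_ge0//.
have := @bernoulli_powR_le (2 * alpha - 2) _ _ z0.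
have -> : 1 + (2 * alpha - 2) * ((1 - v)^-1 / 2 - 1) = 1 + (alpha - 1) * ((1 - v)^-1 - 2) by field; case/andP: v01; lra.
by apply; apply/andP; split; lra.
Qed.

Lemma dkap_le (v : R) : 3 / 2 <= alpha -> 0 < v < 1 ->
  dkap v <= v `^ (1 - alpha) * (1 - v) `^ (- alpha - 1).
Proof.
have a1 := alpha_gt1; have a2 := alpha_lt2.
move=> a32 v01; rewrite odds_powR// /dkap [2 `^ _ * _]mulrA (mulrCA (2 `^ _)) ler_wpM2r ?sqr_ge0//.
rewrite ler_wpM2l ?powR_ge0//.
have y0 : 0 < (1 - v)^-1 by case/andP: v01 => ? ?; rewrite invr_gt0 subr_gt0.
have z0 : 0 < (1 - v)^-1 / 2 by rewrite divr_gt0.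
have {2}-> : (1 - v)^-1 = 2 * ((1 - v)^-1 / 2) by rewrite mulrC divfK.
rewrite powRM ?(ltW z0)// ler_wpM2l ?powR_ge0//.
have := @bernoulli_powR_ge (2 * alpha - 2) _ _ z0.
have -> : 1 + (2 * alpha - 2) * ((1 - v)^-1 / 2 - 1) = 1 + (alpha - 1) * ((1 - v)^-1 - 2) by field; case/andP: v01; lra.
by apply; lra.
Qed.

(* The limit of [(H (t - v t) - H t - v t F t) / (t F t)], see [q_lim]. *)
Definition qlim (v : R) := ((1 - v) `^ (1 - alpha) - 1) / (alpha - 1) - v.

(* [Phi1] and [Phi2] stand for antiderivatives of [qlim v * alpha v^(-alpha-1)] and
   [(1-v)^(1-alpha) / (alpha-1) * alpha v^(-alpha-1)]; integrating by parts, both reduce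
   to the integral that [kap] bounds. *)
Definition Phi1 (v : R) := - (qlim v * v `^ (- alpha)) -
  ((1 - v) `^ (- alpha) - 1) * v `^ (1 - alpha) / (alpha - 1) + alpha / (alpha - 1) * kap v.

(** The wanted integrand plus the defect of [dkap], so that the sign of this defect alone decides
    which bound [Phi1] gives. *)
Definition dPhi1 (v : R) := qlim v * (alpha * v `^ (- alpha - 1)) +
  alpha / (alpha - 1) * (dkap v - v `^ (1 - alpha) * (1 - v) `^ (- alpha - 1)).

Definition Phi2 (v : R) := - (alpha / (alpha - 1) * kap (1 - v)).

Definition dPhi2 (v : R) := alpha / (alpha - 1) * dkap (1 - v).

Lemma is_derive_qlim (v : R) : v < 1 -> is_derive v 1 qlim ((1 - v) `^ (- alpha) - 1).
Proof.
have a1 := alpha_gt1; have a2 := alpha_lt2.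
move=> v1; have D := is_derive_onem_powR (1 - alpha) v1.
rewrite /qlim; apply: is_derive_eq; rewrite /GRing.scale/=.
have -> : 1 - alpha - 1 = - alpha by ring.
by field; rewrite gt_eqF// subr_gt0.
Qed.

Lemma is_derive_Phi1 (v : R) : 0 < v < 1 -> is_derive v 1 Phi1 (dPhi1 v).
Proof.
have a1 := alpha_gt1; have a2 := alpha_lt2.
move=> v01; have /andP[v0 v1] := v01.
have D1 := is_derive_kap v01; have D2 := is_derive_qlim v1.
have D3 := is_derive_onem_powR (- alpha) v1.
have D4 := @is_derive1_powR R (- alpha) v v0.
have D5 := @is_derive1_powR R (1 - alpha) v v0.
rewrite /Phi1; apply: is_derive_eq; rewrite /GRing.scale/= /dPhi1.
have -> : 1 - alpha - 1 = - alpha by ring.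
by field; rewrite gt_eqF// subr_gt0.
Qed.

Lemma is_derive_Phi2 (v : R) : 0 < v < 1 -> is_derive v 1 Phi2 (dPhi2 v).
Proof.
have a1 := alpha_gt1; have a2 := alpha_lt2.
move=> /andP[v0 v1].
have v01 : 0 < 1 - v < 1 by apply/andP; split; lra.
have D1 := is_derive_kap v01.
have D2 := is_derive_onem v.
have D3 := @is_derive1_comp _ kap (fun x => 1 - x) v _ _ D1 D2.
have D4 : is_derive v 1 (fun x => kap (1 - x)) (dkap (1 - v) * -1) := D3.
by rewrite /Phi2; apply: is_derive_eq; rewrite /GRing.scale/= /dPhi2; ring.
Qed.

(** At the splitting point 1/2 the odds v/(1-v) equal 1, so every power that occurs is a power of 2.
    The last factor changes sign exactly at alpha = 3/2. *)
Lemma Phi_total : Phi1 (1 / 2) - Phi2 (1 / 2) - 2 `^ alpha / (alpha - 1)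
    - 2 `^ (alpha - 1) / (alpha - 1) - 2 `^ alpha / 2 =
  2 `^ alpha ^+ 2 / (alpha - 1) * (alpha / (3 - alpha) - 1).
Proof.
have a1 := alpha_gt1; have a2 := alpha_lt2.
have h2 : 1 - 1 / 2 = 1 / 2 :> R by field.
have hp x : (1 / 2 : R) `^ x = 2 `^ (- x) by rewrite div1r -powR_inv1// -powRrM mulN1r.
have p2 : 2 `^ (alpha - 1) = 2 `^ alpha / 2 :> R by rewrite gt0_powRD// powR_inv1.
have p4 : 2 `^ (2 * alpha - 2) = 2 `^ alpha ^+ 2 / 4 :> R.
  rewrite (_ : 2 * alpha - 2 = (alpha - 1) + (alpha - 1)); last by ring.
  by rewrite gt0_powRD// p2; field.
rewrite /Phi1 /Phi2 /kap /qlim !h2 divff ?gt_eqF ?divr_gt0// !powR1 !hp !opprK opprB p2 p4.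
by field; rewrite !gt_eqF// subr_gt0; lra.
Qed.

(** The maximum over [0, 1/2] of alpha (1-v)^(-alpha-1), the derivative of (1-v)^(-alpha). *)
Let C0 := alpha * 2 `^ (alpha + 1).

Lemma onem_powR_le (p v : R) : 0 <= p -> v <= 1 / 2 -> (1 - v) `^ (- p) <= 2 `^ p.
Proof.
have a1 := alpha_gt1; have a2 := alpha_lt2.
move=> p0 v2; have y0 : 0 < 1 - v by lra.
rewrite -[- p]mulN1r powRrM powR_inv1 ?(ltW y0)// ge0_ler_powR// ?nnegrE ?invr_ge0 ?(ltW y0)//.
by rewrite invf_ple ?posrE//; lra.
Qed.

Lemma onem_powR_bound (v : R) : 0 <= v <= 1 / 2 -> 0 <= (1 - v) `^ (- alpha) - 1 <= C0 * v.
Proof.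
have a1 := alpha_gt1; have a2 := alpha_lt2.
move=> /andP[v0 v2]; apply/andP; split.
  rewrite subr_ge0 -[leLHS](powRr0 (1 - v)); apply: ger_powR; last by lra.
  by apply/andP; split; lra.
pose h x := C0 * x - (1 - x) `^ (- alpha).
suff : h 0 <= h v by rewrite /h subr0 powR1; lra.
apply: (@is_derive_ndecr _ h
  (fun x => C0 - alpha * (1 - x) `^ (- (alpha + 1))) _ _ v0) => x /andP[x0 xv].
  have x1 : x < 1 by lra.
  have D := is_derive_onem_powR (- alpha) x1.
  apply: is_derive_eq; rewrite /GRing.scale/=.
  by have -> : - (alpha + 1) = - alpha - 1; ring.
rewrite subr_ge0 ler_pM2l ?onem_powR_le//; lra.
Qed.

Lemma qlim_bound (v : R) : 0 <= v <= 1 / 2 -> 0 <= qlim v <= C0 * v ^+ 2.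
Proof.
have a1 := alpha_gt1; have a2 := alpha_lt2.
move=> /andP[v0 v2].
have q0 : qlim 0 = 0 by rewrite /qlim !subr0 powR1 subrr mul0r.
apply/andP; split.
  rewrite -q0; apply: (@is_derive_ndecr _ qlim (fun x => (1 - x) `^ (- alpha) - 1) _ _ v0)
    => x /andP[x0 xv].
    by apply: is_derive_qlim; lra.
  have /andP[] // : 0 <= (1 - x) `^ (- alpha) - 1 <= C0 * x.
  by apply: onem_powR_bound; apply/andP; split; lra.
pose h x := C0 * v * x - qlim x.
suff : h 0 <= h v by rewrite /h q0 expr2; lra.
apply: (@is_derive_ndecr _ h
  (fun x => C0 * v - ((1 - x) `^ (- alpha) - 1)) _ _ v0) => x /andP[x0 xv].
  have D := @is_derive_qlim x; have {}D := D ltac:(lra).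
  by apply: is_derive_eq; rewrite /GRing.scale/=; ring.
have /andP[_ hx] : 0 <= (1 - x) `^ (- alpha) - 1 <= C0 * x.
  by apply: onem_powR_bound; apply/andP; split; lra.
have : C0 * x <= C0 * v by rewrite ler_wpM2l// mulr_ge0 ?powR_ge0//; lra.
lra.
Qed.

(** These are the boundary terms left by cutting at [d] and [1 - d]. They are of order d^(2-alpha)
    because [qlim] vanishes to second order at 0 and the leading term of [kap] is the odds to the
    power 2 - alpha; alpha < 2 makes them small with [d]. *)
Lemma Phi_near0 : exists2 C, 0 <= C & forall d, 0 < d <= 1 / 2 ->
  `|Phi1 d - Phi2 (1 - d)| <= C * d `^ (2 - alpha).
Proof.
have a1 := alpha_gt1; have a2 := alpha_lt2.
have {}a1 : 0 < alpha - 1 by rewrite subr_gt0.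
have C00 : 0 <= C0 by rewrite mulr_ge0 ?powR_ge0//; lra.
pose K := 2 `^ (2 * alpha - 2) * ((1 + (alpha - 1) / (3 - alpha)) * 2 `^ (2 - alpha)).
have K0 : 0 <= K by rewrite !mulr_ge0 ?powR_ge0// addr_ge0// divr_ge0; lra.
pose c2 := 2 * alpha / (alpha - 1).
have c20 : 0 <= c2 by rewrite divr_ge0//; lra.
exists (C0 + C0 / (alpha - 1) + c2 * K).
  apply: addr_ge0; last exact: mulr_ge0.
  by apply: addr_ge0 => //; apply: divr_ge0 => //; exact: ltW.
move=> d d2; have /andP[d0 dh] := d2; pose D := d `^ (2 - alpha).
have d2' : 0 <= d <= 1 / 2 by rewrite ltW.
have eD1 : d ^+ 2 * d `^ (- alpha) = D.
  by rewrite -powR_mulrn ?ltW// -gt0_powRD.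
have eD2 : d * d `^ (1 - alpha) = D.
  rewrite -{1}(powRr1 (ltW d0)) -gt0_powRD//; congr (_ `^ _); ring.
have kd : 0 <= kap d <= K * D.
  have w0 : 0 < d / (1 - d) by rewrite divr_gt0//; lra.
  have w2 : d / (1 - d) <= 2 * d by rewrite ler_pdivrMr; [nra|lra].
  have hw : (d / (1 - d)) `^ (2 - alpha) <= 2 `^ (2 - alpha) * D.
    rewrite -powRM ?(ltW d0)//; apply: ge0_ler_powR; rewrite ?nnegrE; lra.
  have hw3 : (d / (1 - d)) `^ (3 - alpha) <= (d / (1 - d)) `^ (2 - alpha).
    by apply: ger_powR; [apply/andP; split; lra|lra].
  have r0 : 0 <= (alpha - 1) / (3 - alpha) by rewrite divr_ge0; lra.
  rewrite /kap /K; apply/andP; split.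
    by rewrite mulr_ge0 ?powR_ge0// addr_ge0 ?powR_ge0// mulr_ge0 ?powR_ge0.
  rewrite -[leRHS]mulrA ler_wpM2l ?powR_ge0//.
  have := ler_wpM2l r0 (le_trans hw3 hw); lra.
have /andP[h10 h11] := onem_powR_bound d2'.
have /andP[h20 h21] := qlim_bound d2'.
have g1 : 0 <= qlim d * d `^ (- alpha) <= C0 * D.
  by rewrite -eD1 mulrA ler_wpM2r ?powR_ge0// mulr_ge0 ?powR_ge0.
have g2 : 0 <= ((1 - d) `^ (- alpha) - 1) * d `^ (1 - alpha) / (alpha - 1) <= C0 / (alpha - 1) * D.
  rewrite -eD2 divr_ge0 ?mulr_ge0 ?powR_ge0 ?(ltW a1)//=.
  rewrite (_ : C0 / _ * _ = C0 * d * d `^ (1 - alpha) / (alpha - 1)); last by ring.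
  by rewrite ler_wpM2r ?invr_ge0 ?(ltW a1)// ler_wpM2r ?powR_ge0.
have -> : Phi1 d - Phi2 (1 - d) = - (qlim d * d `^ (- alpha)) -
  ((1 - d) `^ (- alpha) - 1) * d `^ (1 - alpha) / (alpha - 1) + c2 * kap d.
  by rewrite /Phi1 /Phi2 subKr /c2; ring.
have g3 : 0 <= c2 * kap d <= c2 * (K * D).
  by case/andP: kd => k0 k1; rewrite ler_wpM2l// mulr_ge0.
rewrite -/D ler_norml; move: g1 g2 g3 => /andP[? ?] /andP[? ?] /andP[? ?].
apply/andP; split; lra.
Qed.

End stieltjes_constants.

(** * The sum X + Z: slopes of H, tail of Z, local bounds, expansion *)

Section residual_life_sum.
Context {d : measure_display} {T : measurableType d} {R : realType}.
Variables (P : probability T R) (X Z : {RV P >-> R}) (alpha : R).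
Hypothesis intX : P.-integrable [set: T] (EFin \o X).
Hypothesis EX_lt0 : ('E_P[X] < 0)%E.
Hypothesis alpha_gt1 : 1 < alpha.
Hypothesis rvX : regularly_varying_tail alpha X.
Hypothesis negX : negligible_left_tail X.
Hypothesis denX : regularly_varying_density alpha X.
Hypothesis indXZ : independent_RV X Z.
Hypothesis resZ : residual_life X Z.

Let F := tail P X.
Let B := tail P Z.
Let m : R := - fine 'E_P[X].
Let H (t : R) : R := \int[P]_w (Num.max (X w - t) 0).
Let E := Eon X.

Let mean_EFin : ('E_P[X] = (- m)%:E)%E.
Proof. by rewrite /m opprK fineK// unlock; exact: integrable_fin_num. Qed.

Let m_gt0 : 0 < m.
Proof. by move: EX_lt0; rewrite mean_EFin lte_fin oppr_lt0. Qed.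

Let F_nonincr : {homo F : s t / s <= t >-> t <= s}.
Proof. by move=> s t; exact: tail_nonincr. Qed.

Let F_ratio u : 0 < u -> F (u * t) / F t @[t --> +oo] --> u `^ (- alpha).
Proof. by move=> u0; exact: regularly_varying_ratio. Qed.

Let F_gt0 t : 0 < F t.
Proof.
have [M [_ HM]] := asymp_equiv_neq0 (rvX ltr01).
pose t1 := Num.max (M + 1) t.
have tt1 : t <= t1 by rewrite /t1 le_max lexx orbT.
apply: lt_le_trans (F_nonincr tt1); rewrite lt_neqAle eq_sym tail_ge0 andbT.
have /HM : M < t1 by rewrite /t1 lt_max ltrDl ltr01.
by rewrite mulf_eq0 negb_or => /andP[].
Qed.

Let B_min t : B t = Num.min 1 (H t / m).
Proof.
rewrite /B resZ Rintegral_tail mulrC; congr (Num.min 1 (_ / _)).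
by rewrite ltr0_norm// -oppr_gt0; exact: m_gt0.
Qed.

Let maxE (Y : {RV P >-> R}) (t : R) : P.-integrable setT (EFin \o Y) ->
  P.-integrable setT (EFin \o (fun w => Num.max (Y w - t) 0)).
Proof.
move=> iY.
have iab : P.-integrable [set: T] (EFin \o (fun w => `|t| + `|Y w|)).
  rewrite (_ : _ \o _ = (fun w => `|t|%:E + `|(Y w)%:E|)%E); last by apply/funext.
  apply: integrableD => //; first exact: finite_measure_integrable_cst.
  by apply: integrable_abse.
apply: le_integrable iab => //.
  apply/measurable_EFinP; apply: measurable_maxr => //.
  exact: measurable_funB.
move=> w _ /=; rewrite lee_fin [leRHS]ger0_norm ?addr_ge0//.
rewrite ger0_norm ?le_max ?lexx ?orbT// ge_max addr_ge0// andbT.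
by rewrite addrC (le_trans (ler_norm _))// (le_trans (ler_normD _ _))// normrN.
Qed.

(** Pointwise, (y-s)^+ - (y-t)^+ lies between (t-s) times the indicators of y > t and of y > s. [Y]
    is general because the bound serves both [X] and its negative part. *)
Let Rint_max_slope (Y : {RV P >-> R}) (s t : R) : P.-integrable setT (EFin \o Y) -> s <= t ->
  (t - s) * tail P Y t <= \int[P]_w (Num.max (Y w - s) 0) - \int[P]_w (Num.max (Y w - t) 0)
    <= (t - s) * tail P Y s.
Proof.
move=> iY st.
have ii u : P.-integrable setT (EFin \o (fun w => ((u < Y w)%R%:R : R))).
  rewrite (_ : (fun w => _) = \1_[set w | u < Y w]); last first.
    apply/funext => w; rewrite indicE.
    by case: (boolP (u < Y w)) => h; [rewrite mem_set|rewrite memNset//=; apply/negP].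
  by apply: integrable_indic => //; exact: measurable_gt.
rewrite -RintegralB//; [|exact: maxE..].
rewrite !tail_Rintegral -!RintegralZl//.
have iB : P.-integrable setT
    (EFin \o (fun w => Num.max (Y w - s) 0 - Num.max (Y w - t) 0)).
  rewrite (_ : _ \o _ = (fun w => (Num.max (Y w - s) 0)%:E - (Num.max (Y w - t) 0)%:E)%E); last by apply/funext.
  by apply: integrableB => //; exact: maxE.
have iZ u : P.-integrable setT (EFin \o (fun w => (t - s) * (u < Y w)%R%:R)).
  rewrite (_ : _ \o _ = (fun w => (t - s)%:E * ((u < Y w)%R%:R)%:E)%E); last by apply/funext.
  by apply: integrableZl => //; exact: ii.
apply/andP; split; apply: le_Rintegral => // w _; rewrite /Num.max !subr_lt0.
  case: (ltP t (Y w)) => h; case: (ltP (Y w) s) => h1; case: (ltP (Y w) t) => h2; rewrite ?mulr1 ?mulr0; lra.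
case: (ltP s (Y w)) => h; case: (ltP (Y w) s) => h1; case: (ltP (Y w) t) => h2; rewrite ?mulr1 ?mulr0; lra.
Qed.

Let H_slope s t : s <= t -> (t - s) * F t <= H s - H t <= (t - s) * F s.
Proof. exact: Rint_max_slope. Qed.

Let H_ge0 t : 0 <= H t.
Proof. by apply: Rintegral_ge0 => w _; rewrite le_max lexx orbT. Qed.

Let B_cvg0 : B t @[t --> +oo] --> 0.
Proof.
have h : (fine \o ccdf Z) t @[t --> +oo] --> (0 : R).
  by apply: fine_cvg; exact: cvg_ccdfy0.
apply: (@cvg_near_eq _ _ _ _ _ h).
apply: nearW => t; rewrite /B /tail /ccdf/=; congr (fine (P _)).
by apply/seteqP; split => w /=; rewrite in_itv/= andbT.
Qed.

(* The tail of [Z] vanishes at infinity, so the minimum in its definition is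
   eventually attained by [H t / m]. *)
Let near_BE : \forall t \near +oo, B t = H t / m.
Proof.
have /cvgr_lt/(_ _ ltr01) := B_cvg0; apply: filterS => t; rewrite B_min /Num.min.
by case: ifP => // _; rewrite ltxx.
Qed.

Let H_cvg0 : H t @[t --> +oo] --> 0.
Proof.
have h : B t * m @[t --> +oo] --> 0 * m by apply: cvgMl; exact: B_cvg0.
rewrite mul0r in h; apply: (@cvg_near_eq _ _ _ _ _ h).
by apply: filterS near_BE => t ->; rewrite divfK// gt_eqF// m_gt0.
Qed.

Let density_bounds (f : R -> R) (a b c1 c2 : R) : continuous_density X f ->
  0 <= c1 -> a <= b -> (forall x, a < x <= b -> c1 <= f x <= c2) ->
  c1 * (b - a) <= F a - F b <= c2 * (b - a).
Proof.
move=> [cf f0 df] c10 ab fc.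
have mf : measurable_fun `]a, b] f by apply: measurable_funTS; exact: continuous_measurable_fun.
have e : (F a - F b)%:E = (\int[lebesgue_measure]_(x in `]a, b]) (f x)%:E)%E.
  rewrite -df// -(Eon1_itv intX ab) /Eon /Rintegral.
  have -> : (\int[P]_w ((X w \in `]a, b])%:R * 1)%:E = P (X @^-1` `]a, b]))%E.
    rewrite -[X in P X]setIT -integral_indic//; last exact: measurable_funPTI.
    by apply: eq_integral => w _; rewrite mulr1 indicE mem_setE.
  by rewrite fineK// fin_num_measure//; exact: measurable_funPTI.
have c (c0 : R) : (\int[lebesgue_measure]_(x in `]a, b]) (c0%:E) = (c0 * (b - a))%:E)%E.
  rewrite integral_cst//= lebesgue_measure_itv/= lte_fin.
  case: ltP => h; first by rewrite -EFinD -EFinM.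
  have -> : b = a by apply/le_anti/andP.
  by rewrite mule0 subrr mulr0.
rewrite -!lee_fin e -!c; apply/andP; split; apply: ge0_le_integral => //=.
all: try exact/measurable_EFinP.
all: by move=> x; rewrite /= ?in_itv/= => /fc /andP[h1 h2]; rewrite lee_fin// (le_trans c10).
Qed.

(** The density values on [t/2, 2t] are comparable to each other, hence to their mean over [t/2, t].
    That mean is (F(t/2) - F(t)) / (t/2), of order F(t)/t. *)
Lemma tail_locally_lipschitz : exists C S : R, [/\ 0 < C, 0 < S &
  forall t s s', S <= t -> t / 2 <= s -> s <= s' -> s' <= 2 * t ->
    F s - F s' <= C * (F t / t) * (s' - s)].
Proof.
have [f [df rvf]] := denX; have [cf f0 _] := df.
have [K [S [K0 S0 HK]]] := regularly_varying_bounded_ratio cf f0 rvf.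
have h2 : 0 < 1 / 2 :> R by lra.
pose c := (1 / 2) `^ (- alpha) + 1 : R.
have cgt : (1 / 2) `^ (- alpha) < c by rewrite ltrDl.
have [M [_ HM]] := F_ratio_le F_gt0 F_ratio h2 cgt.
have c0 : 0 < c by rewrite addr_gt0// powR_gt0.
exists (2 * K * c), (Num.max (2 * S) (M + 1)); split.
- by rewrite !mulr_gt0.
- by rewrite lt_max mulr_gt0.
move=> t s s'; rewrite ge_max => /andP[St Mt] ts ss' s't.
have t0 : 0 < t by lra.
have fb u : t / 2 <= u <= 2 * t -> f u <= 2 * K * c * (F t / t).
  move=> /andP[u1 u2].
  have /andP[h _] : f u / K * (t - t / 2) <= F (t / 2) - F t <= K * f u * (t - t / 2).
    apply: density_bounds df _ _ _; [by rewrite divr_ge0// ltW|by lra|].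
    move=> x /andP[x1 x2]; apply/andP; split.
      by rewrite ler_pdivrMr// mulrC; apply: HK; [lra|apply/andP; split; lra].
    by apply: HK; [lra|apply/andP; split; lra].
  have h3 : F (t / 2) <= c * F t by rewrite mulrC -div1r; apply: HM; lra.
  have : f u / K * (t / 2) <= c * F t by have := F_gt0 t; lra.
  rewrite -ler_pdivlMr; last by lra.
  rewrite ler_pdivrMr// => /le_trans; apply.
  by rewrite le_eqVlt; apply/orP; left; apply/eqP; field; rewrite gt_eqF.
have /andP[_] : 0 * (s' - s) <= F s - F s' <= 2 * K * c * (F t / t) * (s' - s).
  apply: density_bounds df _ ss' _ => // x /andP[x1 x2]; rewrite f0/=.
  by apply: fb; apply/andP; split; lra.
by [].
Qed.

Let Xneg : {RV P >-> R} := X^\-.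

Let L (t : R) : R := \int[P]_w (Num.max (X^\- w - t) 0).

(** [L] is nonincreasing and [h t <= t] eventually, so [L t] is at most the integral from [h t] in
    (A2); for t > 0 the tails of [X^\+] and [X] coincide. *)
Lemma left_tail_negligible e : 0 < e -> \forall t \near +oo, L t <= e * (t * F t).
Proof.
move=> e0; have [h [hy ht hL]] := negX.
have iXn : P.-integrable setT (EFin \o X^\-) by exact: integrable_funrneg.
move/eqoP : ht => /(_ _ ltr01) ht.
move/eqoP : hL => /(_ _ e0) hL.
have t0 := nbhs_pinfty_gt (num_real (0 : R)).
near=> t.
have tt0 : 0 < t by near: t; exact: t0.
have htt : h t <= t.
  have : `|h t| <= 1 * `|t| by near: t; exact: ht.
  by rewrite mul1r (gtr0_norm tt0); apply: le_trans; exact: ler_norm.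
have hLt : `|\int[lebesgue_measure]_(s in `[h t, +oo[) tail P X^\- s| <=
    e * `|t * tail P X^\+ t|.
  by near: t; exact: hL.
have Fp : tail P X^\+ t = F t.
  rewrite /F /tail; congr (fine (P _)); apply/seteqP; split => w /=.
    by rewrite /funrpos lt_max => /orP[//|]; rewrite ltNge ltW.
  by rewrite /funrpos lt_max => ->.
rewrite Fp (gtr0_norm (mulr_gt0 tt0 (F_gt0 t))) in hLt.
apply: le_trans hLt; rewrite (Rintegral_tail P Xneg) -/(L (h t)).
apply: le_trans (ler_norm _).
have /andP[h1 _] := Rint_max_slope (Y := Xneg) iXn htt.
rewrite -subr_ge0; apply: le_trans h1.
by rewrite mulr_ge0 ?tail_ge0// subr_ge0.
Unshelve. all: end_near. Qed.

(* The second-order remainder of the convex function [x |-> H (t - x)] at [0]. *)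
Let q (t x : R) := H (t - x) - H t - F t * x.

Let ab_H t i : affinely_bounded i (fun x => H (t - x)).
Proof.
split.
  apply: (measurableT_comp (f := H)) => //; last exact: measurable_funB.
  apply: nonincreasing_measurable => // s u su.
  have /andP[h _] := H_slope su; rewrite -subr_ge0; apply: le_trans h.
  by rewrite mulr_ge0 ?subr_ge0// tail_ge0.
exists (H t), 1 => x _; rewrite mul1r (ger0_norm (H_ge0 _)).
have F1 s : F s <= 1 by exact: tail_le1.
have [x0|x0] := leP 0 x.
  have tx : t - x <= t by lra.
  have /andP[_ h] := H_slope tx.
  have := ler_wpM2l x0 (F1 (t - x)); rewrite (ger0_norm x0); lra.
have tx : t <= t - x by lra.
have /andP[h _] := H_slope tx.
have xF : 0 <= - x * F (t - x) by rewrite mulr_ge0 ?tail_ge0// oppr_ge0 ltW.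
by have := normr_ge0 x; lra.
Qed.

Let ab_B t i : affinely_bounded i (fun x => B (t - x)).
Proof.
split; first by apply: (measurableT_comp (f := B)); [exact: measurable_tail|exact: measurable_funB].
by exists 1, 0 => x _; rewrite mul0r addr0 ger0_norm ?tail_le1// tail_ge0.
Qed.

Let q_split t : q t = (fun x => H (t - x) + (- H t * 1 + - F t * x)).
Proof. by apply/funext => x; rewrite /q; ring. Qed.

Let ab_q t i : affinely_bounded i (q t).
Proof.
rewrite q_split; apply: abD => //; apply: abD; apply: abZ; [exact: ab_cst|exact: ab_id].
Qed.

Let q_ge0 t x : 0 <= q t x.
Proof.
have [x0|x0] := leP 0 x.
  have tx : t - x <= t by lra.
  by have /andP[h _] := H_slope tx; rewrite /q; lra.
have tx : t <= t - x by lra.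
by have /andP[_ h] := H_slope tx; rewrite /q; lra.
Qed.

(** For either sign of [x], the slope of [H] between [t - x] and [t] lies between minus the two end
    values of [F]; one end gives [q_ge0], the other this bound. *)
Let q_le t x : q t x <= x * (F (t - x) - F t).
Proof.
have [x0|x0] := leP 0 x.
  have tx : t - x <= t by lra.
  by have /andP[_ h] := H_slope tx; rewrite /q; lra.
have tx : t <= t - x by lra.
by have /andP[h _] := H_slope tx; rewrite /q; lra.
Qed.

Let EonT1 : E `]-oo, +oo[ (fun=> 1) = 1.
Proof. by rewrite /E EonT /Rintegral integral_cst//= probability_setT mul1e. Qed.

Let EonTid : E `]-oo, +oo[ id = - m.
Proof. by rewrite /E EonT /Rintegral /m opprK unlock. Qed.

Let Eon_gt_id c : E `]c, +oo[ id = H c + c * F c.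
Proof.
have -> : H c = E `]c, +oo[ (fun x => x + - c * 1).
  apply: eq_Rintegral => w _; rewrite in_itv/= andbT mulr1.
  have [h|h] := ltP c (X w); first by rewrite mul1r max_l// subr_ge0 ltW.
  by rewrite mul0r max_r// subr_le0.
rewrite /E EonD//; [|exact: ab_id|by apply: abZ; exact: ab_cst].
rewrite EonZ//; last exact: ab_cst.
by rewrite Eon1_gt -/F mulNr subrK.
Qed.

(* Taylor expansion on [X <= t/2]; the first-order term [F t * E[X]] produces the
   [- m * F t] that cancels [P(X > t)]. *)
Lemma tail_add_expansion t : (forall s, t / 2 <= s -> B s = H s / m) -> 0 <= t ->
  m * (tail P (fun w => X w + Z w) t - B t) =
  E `]-oo, t / 2] (q t) + m * (E `]t / 2, +oo[ (fun x => B (t - x)) - F t)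
  - (H t * F (t / 2) + F t * H (t / 2) + t / 2 * F (t / 2) * F t).
Proof.
move=> BH t0; have m0 : m != 0 by rewrite gt_eqF// m_gt0.
have Espl g : affinely_bounded `]-oo, +oo[ g ->
    E `]-oo, +oo[ g = E `]-oo, t / 2] g + E `]t / 2, +oo[ g.
  exact: (@Eon_split _ _ _ _ _ intX -oo%O +oo%O (t / 2)).
have -> : tail P (fun w => X w + Z w) t = E `]-oo, +oo[ (fun x => B (t - x)).
  by rewrite tail_add// /E EonT.
rewrite Espl//.
have -> : B t = H t / m by apply: BH; lra.
have e1 : m * E `]-oo, t / 2] (fun x => B (t - x)) =
    E `]-oo, t / 2] (q t) + H t * (1 - F (t / 2)) + F t * (- m - H (t / 2) - t / 2 * F (t / 2)).
  have Eid : E `]-oo, t / 2] id = - m - H (t / 2) - t / 2 * F (t / 2).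
    by have := Espl _ (ab_id _); rewrite EonTid Eon_gt_id; lra.
  have E1 : E `]-oo, t / 2] (fun=> 1) = 1 - F (t / 2).
    by have := Espl _ (ab_cst _ 1); rewrite EonT1 [E `]_, +oo[ _]Eon1_gt -/F; lra.
  rewrite -Eid -E1 q_split /E.
  rewrite EonD//; last by apply: abD; apply: abZ; [exact: ab_cst|exact: ab_id].
  rewrite EonD//; [|by apply: abZ; exact: ab_cst|by apply: abZ; exact: ab_id].
  rewrite !EonZ//; [|exact: ab_id|exact: ab_cst].
  rewrite -EonZ//.
  have -> : Eon X `]-oo, t / 2] (fun x => m * B (t - x)) = Eon X `]-oo, t / 2] (fun x => H (t - x)).
    apply: eq_Eon => x; rewrite in_itv/= => xt.
    by rewrite BH; [rewrite mulrCA divff// mulr1|lra].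
  by ring.
rewrite mulrBr mulrDr e1 mulrCA divff// ; ring.
Qed.

(** * Normalised limits where X/t stays away from 0 and 1 *)

Let nrm (t : R) := t * F t ^+ 2.

Let nrm_gt0 t : 0 < t -> 0 < nrm t.
Proof. by move=> t0; rewrite mulr_gt0// exprn_gt0// F_gt0. Qed.

Let E_add u v w g : u <= v -> v <= w -> affinely_bounded `]u, w] g ->
  E `]u, w] g = E `]u, v] g + E `]v, w] g.
Proof. by move=> uv vw; apply: (@Eon_split _ _ _ _ _ intX (BRight u) (BRight w) v). Qed.

Let E_bounds u v g c1 c2 : u <= v -> affinely_bounded `]u, v] g ->
  (forall x, u < x -> x <= v -> c1 <= g x <= c2) ->
  c1 * (F u - F v) <= E `]u, v] g <= c2 * (F u - F v).
Proof.
move=> uv bg gc; rewrite -(Eon1_itv intX uv).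
by apply: Eon_bounds => // x; rewrite in_itv/= => /andP[? ?]; exact: gc.
Qed.

(** Monotonicity of [gt t] squeezes each cell between its end values times the mass F(ut) - F(vt),
    and both factors converge pointwise after normalisation. Right ends feed the upper estimate,
    left ends the one for the opposite. *)
Lemma limsup_Eon (a b K : R) (g Phi dPhi : R -> R) (gt : R -> R -> R) :
  0 < a -> a < b -> 0 <= K ->
  (forall t i, affinely_bounded i (gt t)) ->
  (forall t x y, 0 < t -> a * t <= x -> x <= y -> gt t x <= gt t y) ->
  (forall v, a <= v -> v <= b -> gt t (v * t) / (t * F t) @[t --> +oo] --> g v) ->
  (forall u v, a <= u -> u <= v -> v <= b -> g v <= g u + K * (v - u)) ->
  (forall x, a <= x <= b -> is_derive x 1 Phi (dPhi x)) ->
  ((forall x, a <= x <= b -> g x * (alpha * x `^ (- alpha - 1)) <= dPhi x) ->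
     limsup_le (fun t => E `]a * t, b * t] (gt t) / nrm t) (Phi b - Phi a)) /\
  ((forall x, a <= x <= b -> dPhi x <= g x * (alpha * x `^ (- alpha - 1))) ->
     limsup_le (fun t => - (E `]a * t, b * t] (gt t) / nrm t)) (- (Phi b - Phi a))).
Proof.
move=> a0 ab K0 gab gmono glim gK dP.
have al0 : 0 <= alpha by rewrite ltW// (lt_trans _ alpha_gt1).
pose J u v t := E `]u * t, v * t] (gt t) / nrm t.
have Jadd u v w t : a <= u -> u <= v -> v <= w -> w <= b -> 0 < t ->
    J u w t = J u v t + J v w t.
  move=> au uv vw wb t0; rewrite /J -mulrDl; congr (_ / _); apply: E_add => //.
    by rewrite ler_pM2r.
  by rewrite ler_pM2r.
have Flim u v : a <= u -> u <= v -> (F (u * t) - F (v * t)) / F t @[t --> +oo]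
    --> u `^ (- alpha) - v `^ (- alpha).
  move=> au uv; have u0 : 0 < u by exact: lt_le_trans au.
  have h := cvgB (F_ratio u0) (F_ratio (lt_le_trans u0 uv)).
  apply: (@cvg_near_eq _ _ _ _ _ (h _)); apply: nearW => t /=.
  by rewrite mulrBl.
have Clim w u v : a <= u -> u <= v -> v <= b -> a <= w -> w <= b ->
    gt t (w * t) * (F (u * t) - F (v * t)) / nrm t @[t --> +oo]
    --> g w * (u `^ (- alpha) - v `^ (- alpha)).
  move=> au uv vb aw wb.
  have h := cvgM (glim w aw wb) (Flim u v au uv).
  apply: (@cvg_near_eq _ _ _ _ _ (h _)).
  apply: filterS (nbhs_pinfty_gt (num_real 0)) => t t0 /=.
  by rewrite /nrm; field; rewrite !gt_eqF// F_gt0.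
have Jb u v t : a <= u -> u <= v -> 0 < t ->
    gt t (u * t) * (F (u * t) - F (v * t)) / nrm t <= J u v t <=
    gt t (v * t) * (F (u * t) - F (v * t)) / nrm t.
  move=> au uv t0; rewrite /J !ler_pM2r ?invr_gt0 ?nrm_gt0//.
  apply: E_bounds => //; first by rewrite ler_pM2r.
  move=> x ux xv; apply/andP; split; apply: gmono => //.
  - by rewrite ler_pM2r.
  - exact: ltW.
  - by rewrite (le_trans _ (ltW ux))// ler_pM2r.
split=> gP.
  apply: (@limsup_stieltjes _ alpha a b K g Phi dPhi (fun _ v => g v) J) => //.
    move=> u v au uv vb; apply: limsup_le_near; last first.
      by apply: cvg_limsup_le; apply: (Clim v u v) => //; exact: le_trans uv.
    apply: filterS (nbhs_pinfty_gt (num_real 0)) => t t0.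
    by have /andP[] := Jb u v t au uv t0.
  move=> u x v au ux xv vb; apply: le_trans (gK x v _ xv vb) _; first exact: le_trans ux.
  by rewrite lerD2l ler_wpM2l// lerD2l lerN2.
have -> : - (Phi b - Phi a) = - Phi b - - Phi a by ring.
apply: (@limsup_stieltjes _ alpha a b K (fun x => - g x) (fun x => - Phi x)
  (fun x => - dPhi x) (fun u _ => - g u) (fun u v t => - J u v t)) => //.
- by move=> u v w t au uv vw wb t0; rewrite (Jadd u v w t)// opprD.
- move=> u v au uv vb.
  apply: (@limsup_le_near _ _
    (fun t => - (gt t (u * t) * (F (u * t) - F (v * t)) / nrm t))).
    apply: filterS (nbhs_pinfty_gt (num_real 0)) => t t0.
    by have /andP[h _] := Jb u v t au uv t0; rewrite lerN2.
  apply: cvg_limsup_le; rewrite mulNr; apply: cvgN.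
  by apply: (Clim u u v) => //; exact: le_trans vb.
- move=> u x v au ux xv vb.
  have h1 := gK u x au ux (le_trans xv vb).
  have h2 : K * (x - u) <= K * (v - u) by rewrite ler_wpM2l// lerD2r.
  by lra.
- by move=> x /dP D; apply: is_deriveN.
- by move=> x /gP; rewrite mulNr lerN2.
Qed.

Let karamataH u : 0 < u ->
  H (u * t) / (t * F t) @[t --> +oo] --> u `^ (1 - alpha) / (alpha - 1).
Proof. exact: H_ratio F_gt0 F_ratio alpha_gt1 H_slope H_cvg0 H_ge0 _. Qed.

Let q_mono t x y : 0 <= x -> x <= y -> q t x <= q t y.
Proof.
move=> x0 xy; have txy : t - y <= t - x by lra.
have /andP[h _] := H_slope txy.
have Ft : F t <= F (t - x) by apply: F_nonincr; lra.
have yx : 0 <= y - x by lra.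
by have := ler_wpM2l yx Ft; rewrite /q; lra.
Qed.

Let q_lim v : v < 1 -> q t (v * t) / (t * F t) @[t --> +oo] --> qlim alpha v.
Proof.
move=> v1; have v10 : 0 < 1 - v by lra.
have h1 := cvgB (karamataH v10) (karamataH ltr01).
have h2 : H ((1 - v) * t) / (t * F t) - H (1 * t) / (t * F t) - v @[t --> +oo] -->
    (1 - v) `^ (1 - alpha) / (alpha - 1) - 1 `^ (1 - alpha) / (alpha - 1) - v.
  by apply: cvgB; [exact: h1|exact: cvg_cst].
rewrite powR1 -mulrBl in h2; apply: (@cvg_near_eq _ _ _ _ _ h2).
apply: filterS (nbhs_pinfty_gt (num_real 0)) => t t0 /=.
rewrite /q (_ : (1 - v) * t = t - v * t); last by ring.
by rewrite mul1r; field; rewrite !gt_eqF// F_gt0.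
Qed.

Let near_ge (M : R) : \forall t \near +oo, M <= t.
Proof. by apply: nbhs_pinfty_ge; exact: num_real. Qed.

Let near_scale_ge (M e : R) : 0 < e -> \forall t \near +oo, M <= e * t.
Proof. by move=> e0; apply: (@near_pinfty_scale _ e [set t | M <= t]) => //; exact: near_ge. Qed.

Let near_gt0 : \forall t \near +oo, (0 : R) < t.
Proof. exact: nbhs_pinfty_gt. Qed.

Section alpha_lt2.
Hypothesis alpha_lt2 : alpha < 2.

Let q_lipschitz u v : u <= v -> v <= 1 / 2 -> qlim alpha v <= qlim alpha u + 2 `^ alpha * (v - u).
Proof.
move=> uv v2; pose h x := 2 `^ alpha * x - qlim alpha x.
suff : h u <= h v by rewrite /h; lra.
apply: (@is_derive_ndecr _ h (fun x => 2 `^ alpha - ((1 - x) `^ (- alpha) - 1)) _ _ uv)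
  => x /andP[x0 xv].
  have x1 : x < 1 by lra.
  have D := is_derive_qlim alpha_gt1 alpha_lt2 x1.
  by apply: is_derive_eq; rewrite /GRing.scale/=; ring.
have al0 : 0 <= alpha by rewrite ltW// (lt_trans _ alpha_gt1).
have x2 : x <= 1 / 2 by lra.
have := onem_powR_le alpha_gt1 alpha_lt2 al0 x2; lra.
Qed.

Lemma limsup_q_middle (e : R) : 0 < e < 1 / 2 ->
  (alpha <= 3 / 2 -> limsup_le (fun t => E `]e * t, 1 / 2 * t] (q t) / nrm t)
    (Phi1 alpha (1 / 2) - Phi1 alpha e)) /\
  (3 / 2 <= alpha -> limsup_le (fun t => - (E `]e * t, 1 / 2 * t] (q t) / nrm t))
    (- (Phi1 alpha (1 / 2) - Phi1 alpha e))).
Proof.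
move=> /andP[e0 e2]; have a1 := alpha_gt1.
have r0 : 0 <= alpha / (alpha - 1) by rewrite divr_ge0//; lra.
have [] := @limsup_Eon e (1 / 2) (2 `^ alpha) (qlim alpha) (Phi1 alpha) (dPhi1 alpha) q e0 e2
  (powR_ge0 _ _) ab_q.
- by move=> t x y t0 ex xy; apply: q_mono => //; rewrite (le_trans _ ex)// mulr_ge0// ltW.
- by move=> v ev v2; apply: q_lim; lra.
- by move=> u v eu uv v2; exact: q_lipschitz.
- by move=> x /andP[ex x2]; apply: is_derive_Phi1 => //; apply/andP; split; lra.
move=> h1 h2; split=> a32; [apply: h1|apply: h2] => x /andP[ex x2];
  have x01 : 0 < x < 1 by (apply/andP; split; lra).
  rewrite /dPhi1 lerDl mulr_ge0// subr_ge0; exact: dkap_ge.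
rewrite /dPhi1 gerDl mulr_ge0_le0// subr_le0; exact: dkap_le.
Qed.

Lemma limsup_H_middle (e : R) : 0 < e < 1 / 2 ->
  (alpha <= 3 / 2 -> limsup_le (fun t => E `]1 / 2 * t, (1 - e) * t] (fun x => H (t - x)) / nrm t)
    (Phi2 alpha (1 - e) - Phi2 alpha (1 / 2))) /\
  (3 / 2 <= alpha -> limsup_le (fun t => - (E `]1 / 2 * t, (1 - e) * t] (fun x => H (t - x)) / nrm t))
    (- (Phi2 alpha (1 - e) - Phi2 alpha (1 / 2)))).
Proof.
move=> /andP[e0 e2]; have a1 := alpha_gt1.
have al0 : 0 <= alpha by lra.
have r0 : 0 <= alpha / (alpha - 1) by rewrite divr_ge0//; lra.
have a0 : 0 < alpha - 1 by lra.
have h20 : 0 < 1 / 2 :> R by lra.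
have h2e : 1 / 2 < 1 - e by lra.
pose g (v : R) := (1 - v) `^ (1 - alpha) / (alpha - 1).
have [] := @limsup_Eon (1 / 2) (1 - e) (e `^ (- alpha)) g
  (Phi2 alpha) (dPhi2 alpha) (fun t x => H (t - x)) h20 h2e (powR_ge0 _ _) ab_H.
- move=> t x y t0 ex xy; have txy : t - y <= t - x by lra.
  have /andP[h _] := H_slope txy.
  rewrite -subr_ge0; apply: le_trans h.
  by rewrite mulr_ge0 ?tail_ge0// subr_ge0.
- move=> v ev v2; have v10 : 0 < 1 - v by lra.
  apply: (@cvg_near_eq _ _ _ _ _ (karamataH v10)); apply: nearW => t.
  by rewrite (_ : (1 - v) * t = t - v * t); last by ring.
(* Up to a constant [g] is [qlim] plus the identity, so its derivative is (1-x)^(-alpha), at most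
   e^(-alpha) when 1 - x >= e. *)
- move=> u v eu uv v2; pose h x := e `^ (- alpha) * x - (qlim alpha x + x).
  suff : h u <= h v.
    have gq y : g y = qlim alpha y + y + (alpha - 1)^-1.
      by rewrite /g /qlim; field; rewrite gt_eqF.
    by rewrite !gq /h; lra.
  apply: (@is_derive_ndecr _ h (fun x => e `^ (- alpha) - (1 - x) `^ (- alpha)) _ _ uv)
    => x /andP[x0 xv].
    have x1 : x < 1 by lra.
    have D := is_derive_qlim alpha_gt1 alpha_lt2 x1.
    by apply: is_derive_eq; rewrite /GRing.scale/=; ring.
  rewrite subr_ge0 !powRN lef_pV2 ?posrE ?powR_gt0//; try lra.
  by apply: ge0_ler_powR; rewrite ?nnegrE//; lra.
- by move=> x /andP[ex x2]; apply: is_derive_Phi2 => //; apply/andP; split; lra.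
have gE x : g x * (alpha * x `^ (- alpha - 1)) =
    alpha / (alpha - 1) * ((1 - x) `^ (1 - alpha) * (1 - (1 - x)) `^ (- alpha - 1)).
  by rewrite subKr /g; ring.
move=> h1 h2; split=> a32; [apply: h1|apply: h2] => x /andP[ex x2];
  have x01 : 0 < 1 - x < 1 by (apply/andP; split; lra).
  by rewrite gE /dPhi2 ler_wpM2l//; exact: dkap_ge.
by rewrite gE /dPhi2 ler_wpM2l//; exact: dkap_le.
Qed.

Lemma cvg_product_terms : (H t * F (t / 2) + F t * H (t / 2) + t / 2 * F (t / 2) * F t) / nrm t
  @[t --> +oo] --> 2 `^ alpha / (alpha - 1) + 2 `^ (alpha - 1) / (alpha - 1) + 2 `^ alpha / 2.
Proof.
have h20 : 0 < 1 / 2 :> R by lra.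
have hp x : (1 / 2 : R) `^ x = 2 `^ (- x) by rewrite div1r -powR_inv1// -powRrM mulN1r.
have h1 := karamataH ltr01; have h2 := karamataH h20; have h3 := F_ratio h20.
rewrite powR1 in h1; rewrite hp opprB in h2; rewrite hp opprK in h3.
have h4 : (H (1 * t) / (t * F t)) * (F (1 / 2 * t) / F t) + H (1 / 2 * t) / (t * F t)
    + 1 / 2 * (F (1 / 2 * t) / F t) @[t --> +oo] -->
    1 / (alpha - 1) * 2 `^ alpha + 2 `^ (alpha - 1) / (alpha - 1) + 1 / 2 * 2 `^ alpha.
  by apply: cvgD; [apply: cvgD; [exact: cvgM|exact: h2]|apply: cvgMr; exact: h3].
have -> : 2 `^ alpha / (alpha - 1) + 2 `^ (alpha - 1) / (alpha - 1) + 2 `^ alpha / 2 =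
  1 / (alpha - 1) * 2 `^ alpha + 2 `^ (alpha - 1) / (alpha - 1) + 1 / 2 * 2 `^ alpha by ring.
apply: (@cvg_near_eq _ _ _ _ _ h4); apply: filterS near_gt0 => t t0.
rewrite mul1r (_ : 1 / 2 * t = t / 2); last by ring.
by rewrite /nrm; field; rewrite !gt_eqF// F_gt0.
Qed.

(** * Error terms for X near 0 and near t *)

Let sqF_gt0 t : 0 < t -> 0 < sqF F t.
Proof. by move=> t0; rewrite mulr_gt0 ?exprn_gt0// F_gt0. Qed.

(** The common form of the error bounds: the constant [N0] left by the first doubling shell
    disappears because [sqF] is unbounded, and the ratio of [sqF] at [e * t] and [t] yields
    e^(2-alpha). *)
Let limsup_sqF (a N0 e : R) : 0 <= a -> 0 <= N0 -> 0 < e ->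
  limsup_le (fun t => (a * sqF F (e * t) + N0) / sqF F t) (a * e `^ (2 - alpha)).
Proof.
move=> a0 N00 e0.
have h1 : a * (e ^+ 2 * (F (e * t) / F t)) @[t --> +oo] --> a * (e ^+ 2 * e `^ (- alpha)).
  by apply: cvgMr; apply: cvgMr; exact: F_ratio.
have e2 : e ^+ 2 * e `^ (- alpha) = e `^ (2 - alpha).
  by rewrite -powR_mulrn ?(ltW e0)// -gt0_powRD.
rewrite e2 in h1; rewrite -[a * _]addr0.
apply: (@limsup_le_near _ _ (fun t => a * (e ^+ 2 * (F (e * t) / F t)) + N0 / sqF F t)).
  apply: filterS near_gt0 => t t0.
  by rewrite le_eqVlt; apply/orP; left; apply/eqP; rewrite /sqF; field; rewrite !gt_eqF// F_gt0.
apply: limsup_leD; first exact: cvg_limsup_le.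
move=> eps eps0; have := sqF_unbounded F_gt0 F_nonincr F_ratio alpha_lt2 (N0 / eps).
apply: filterS2 near_gt0 => t t0 h.
by rewrite add0r ler_pdivrMr ?sqF_gt0// -ler_pdivrMl// mulrC.
Qed.

Let ab_sqr (i : interval R) (c : R) : {in i, forall x, `|x| <= c} ->
  affinely_bounded i (fun x : R => x ^+ 2).
Proof.
move=> ic; split; first exact: measurable_funX.
exists 0, c => x xi; rewrite add0r normrX expr2 ler_wpM2r//; exact: ic.
Qed.

Let ab_sqr_itv (a b : R) : affinely_bounded `]a, b] (fun x : R => x ^+ 2).
Proof.
apply: (@ab_sqr _ (`|a| + `|b|)) => x; rewrite in_itv/= => /andP[ax xb].
rewrite ler_norml; apply/andP; split.
  by have := ler_norm (- a); have := normr_ge0 b; rewrite normrN; lra.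
by have := ler_norm b; have := normr_ge0 a; lra.
Qed.

Let sqr_ge0_itv a b : 0 <= E `]a, b] (fun x : R => x ^+ 2).
Proof. by apply: Eon_ge0 => x _; exact: sqr_ge0. Qed.

(** The shell ]s, 2s] contributes at most (2s)^2 F(s), four times [sqF], and the doubling bound sums
    the shells. *)
Lemma right_second_moment : exists A N0 S : R, [/\ 0 <= A, 0 <= N0, 0 < S &
  forall t, S <= t -> E `]0, t] (fun x : R => x ^+ 2) <= A * sqF F t + N0].
Proof.
have [A [S [A0 S0 HA]]] := doubling_bound F_gt0 F_ratio alpha_lt2.
pose N s := E `]0, s] (fun x : R => x ^+ 2).
exists (A * 4), (N (2 * S)), S; split=> //; first by rewrite mulr_ge0// ltW.
  exact: sqr_ge0_itv.
move=> t St; apply: (HA N 4 (N (2 * S)) S t) => //; first exact: sqr_ge0_itv.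
  move=> s /andP[Ss s2] _; rewrite {2}/N (@E_add 0 s)//; try lra.
  by rewrite lerDl sqr_ge0_itv.
move=> s Ss _; rewrite /N (@E_add 0 s (2 * s)); [|lra|lra|exact: ab_sqr_itv].
rewrite lerD2l; have s0 : 0 < s by lra.
have /andP[_ h] : 0 * (F s - F (2 * s)) <= E `]s, 2 * s] (fun x : R => x ^+ 2)
    <= (2 * s) ^+ 2 * (F s - F (2 * s)).
  apply: E_bounds; [lra|exact: ab_sqr_itv|move=> x sx x2].
  by rewrite sqr_ge0 ler_pXn2r// ?nnegrE; lra.
apply: le_trans h _; rewrite /sqF.
have : 0 <= s ^+ 2 * F (2 * s) by rewrite mulr_ge0 ?tail_ge0// sqr_ge0.
by rewrite exprMn; lra.
Qed.

(** The remainder is at most X (F(t-X) - F(t)), hence C (F(t)/t) X^2 by the Lipschitz bound, which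
    leaves a truncated second moment. *)
Lemma limsup_q_right : exists2 C, 0 <= C & forall e, 0 < e <= 1 / 2 ->
  limsup_le (fun t => E `]0, e * t] (q t) / nrm t) (C * e `^ (2 - alpha)).
Proof.
have [A [N0 [S [A0 N00 S0 HA]]]] := right_second_moment.
have [C [S' [C0 S'0 HC]]] := tail_locally_lipschitz.
exists (C * A); first by rewrite mulr_ge0// ltW.
move=> e /andP[e0 e2].
have CN0 : 0 <= C * N0 by rewrite mulr_ge0// ltW.
have CA0 : 0 <= C * A by rewrite mulr_ge0// ltW.
apply: limsup_le_near (limsup_sqF CA0 CN0 e0).
apply: filterS3 near_gt0 (near_ge S') (near_scale_ge S e0) => t t0 S't Ste.
have et2 : e * t <= t / 2 by have := ler_wpM2r (ltW t0) e2; lra.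
have Ft0 : 0 <= C * (F t / t) by rewrite mulr_ge0 ?divr_ge0 ?tail_ge0// ltW.
have h1 : E `]0, e * t] (q t) <= E `]0, e * t] (fun x => C * (F t / t) * x ^+ 2).
  apply: le_Eon => //; first by apply: abZ; exact: ab_sqr_itv.
  move=> x; rewrite in_itv/= => /andP[x0 xet]; apply: le_trans (q_le t x) _.
  have : F (t - x) - F t <= C * (F t / t) * (t - (t - x)) by apply: HC; lra.
  by rewrite subKr => /(ler_wpM2l (ltW x0)); lra.
rewrite /E EonZ// in h1.
have h2 := ler_wpM2l Ft0 (HA _ Ste).
rewrite ler_pdivrMr ?nrm_gt0//; apply: le_trans h1 _; apply: le_trans h2 _.
by rewrite le_eqVlt; apply/orP; left; apply/eqP; rewrite /nrm /sqF; field; rewrite !gt_eqF// F_gt0.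
Qed.

(* The increment over [t - 2 s < X <= t - s] is at most [B s] times the Lipschitz
   bound [C (F t / t) s], hence of order [(F t / t) s^2 F s]. *)
Lemma limsup_B_near : exists2 C, 0 <= C & forall e, 0 < e <= 1 / 2 ->
  limsup_le (fun t => m * E `](1 - e) * t, t] (fun x => B (t - x)) / nrm t)
    (C * e `^ (2 - alpha)).
Proof.
have [A [S0 [A0 S00 HA]]] := doubling_bound F_gt0 F_ratio alpha_lt2.
have [C [S' [C0 S'0 HC]]] := tail_locally_lipschitz.
pose K := (alpha - 1)^-1 + 1.
have K0 : 0 < K by rewrite addr_gt0// invr_gt0 subr_gt0.
have K1 : (alpha - 1)^-1 < K by rewrite ltrDl.
have [M [_ HM]] := karamata_le F_gt0 F_ratio alpha_gt1 H_slope H_cvg0 K1.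
have mp := m_gt0; have C0' := ltW C0; have K0' := ltW K0.
pose s0 := Num.max S0 (M + 1).
have s00 : 0 < s0 by rewrite lt_max S00.
have s00' := ltW s00.
have Bs s : s0 <= s -> B s <= K * (s * F s) / m.
  rewrite ge_max => /andP[_ Ms]; rewrite B_min ge_min; apply/orP; right.
  by rewrite ler_pM2r ?invr_gt0//; apply: HM; lra.
exists (C * K * A); first by rewrite !mulr_ge0// ltW.
move=> e /andP[e0 e2]; pose c2 := m * (C * (2 * s0)).
have c20 : 0 <= c2 by rewrite !mulr_ge0// ltW.
have CA0 : 0 <= C * K * A by rewrite !mulr_ge0// ltW.
apply: limsup_le_near (limsup_sqF CA0 c20 e0).
apply: filterS3 near_gt0 (near_ge S') (near_scale_ge s0 e0) => t t0 S't ste.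
have et2 : e * t <= t / 2 by have := ler_wpM2r (ltW t0) e2; lra.
pose V s := E `]t - s, t] (fun x => B (t - x)).
have Ft0 : 0 <= F t / t by rewrite divr_ge0 ?tail_ge0// ltW.
(* [V] depends on [t], which is why the doubling constants are uniform over the function they are
   applied to. Stopping at level [e * t] keeps all points above [t / 2], within reach of the
   Lipschitz bound. *)
have hV : V (e * t) <= A * (C * K / m * (F t / t)) * sqF F (e * t) + C * (F t / t) * (2 * s0).
  apply: (HA V _ _ s0 (e * t)) => //.
  - by rewrite mulr_ge0// divr_ge0 ?mulr_ge0// ltW.
  - by apply: mulr_ge0; apply: mulr_ge0.
  - by rewrite le_max lexx.
  - move=> s /andP[h1 h2] h3.
    have /andP[_ h] : 0 * (F (t - s) - F t) <= V s <= 1 * (F (t - s) - F t).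
      apply: E_bounds => //; first by lra.
      by move=> x _ _; rewrite tail_ge0 tail_le1.
    have h4 : F (t - s) - F t <= C * (F t / t) * (t - (t - s)) by apply: HC; lra.
    have h5 : C * (F t / t) * s <= C * (F t / t) * (2 * s0).
      by apply: ler_wpM2l; [exact: mulr_ge0|exact: ltW].
    rewrite subKr in h4; lra.
  - move=> s ss0 s2; rewrite /V (@E_add (t - 2 * s) (t - s))//; try lra.
    rewrite addrC lerD2l.
    have /andP[_ h] : 0 * (F (t - 2 * s) - F (t - s)) <=
        E `]t - 2 * s, t - s] (fun x => B (t - x)) <= B s * (F (t - 2 * s) - F (t - s)).
      apply: E_bounds => //; first by lra.
      by move=> x h1 h2; rewrite tail_ge0/=; apply: tail_nonincr; lra.
    have h4 : F (t - 2 * s) - F (t - s) <= C * (F t / t) * (t - s - (t - 2 * s)) by apply: HC; lra.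
    have e4 : t - s - (t - 2 * s) = s by ring.
    rewrite e4 in h4.
    have h5 : B s * (F (t - 2 * s) - F (t - s)) <= B s * (C * (F t / t) * s).
      by rewrite ler_wpM2l ?tail_ge0.
    have h6 : B s * (C * (F t / t) * s) <= K * (s * F s) / m * (C * (F t / t) * s).
      by apply: ler_wpM2r; [apply: mulr_ge0; [exact: mulr_ge0|lra]|exact: Bs].
    have -> : C * K / m * (F t / t) * sqF F s = K * (s * F s) / m * (C * (F t / t) * s).
      by rewrite /sqF; ring.
    lra.
have -> : (1 - e) * t = t - e * t by ring.
rewrite -/(V _) ler_pdivrMr ?nrm_gt0//.
have := ler_wpM2l (ltW mp) hV; move=> /le_trans; apply.
rewrite le_eqVlt; apply/orP; left; apply/eqP; rewrite /nrm /c2 /sqF.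
by field; rewrite !gt_eqF// ?F_gt0//.
Qed.

(** * The contribution of negative X *)

Let E_add_Ny v w g : v <= w -> affinely_bounded `]-oo, w] g ->
  E `]-oo, w] g = E `]-oo, v] g + E `]v, w] g.
Proof. by move=> vw; apply: (@Eon_split _ _ _ _ _ intX -oo%O (BRight w) v). Qed.

Let ab_opp i : affinely_bounded i (fun x : R => -1 * x).
Proof. by apply: abZ; exact: ab_id. Qed.

(** Where -X >= c one has -X <= 2 (-X - c/2); halving the level absorbs the term c P(X <= -c). *)
Lemma left_first_moment c : 0 <= c -> E `]-oo, - c] (fun x => -1 * x) <= 2 * L (c / 2).
Proof.
move=> c0; have iXn : P.-integrable setT (EFin \o X^\-) by exact: integrable_funrneg.
have iM := maxE (Y := Xneg) (c / 2) iXn.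
rewrite /E /L -RintegralZl//; apply: le_Rintegral => //.
- by apply: integrable_Eon => //; exact: ab_opp.
- rewrite (_ : _ \o _ = (fun w => 2%:E * (Num.max (X^\- w - c / 2) 0)%:E)%E); last by apply/funext.
  exact: integrableZl.
move=> w _; rewrite in_itv/=; have [h|h] := leP (X w) (- c).
  rewrite mul1r; apply: le_trans (_ : 2 * (X^\- w - c / 2) <= _).
    have : - X w <= X^\- w by rewrite /funrneg le_max lexx.
    by lra.
  by rewrite ler_wpM2l// le_max lexx.
by rewrite mul0r mulr_ge0// le_max lexx orbT.
Qed.

Let half_ratio : exists c, 0 < c /\ \forall t \near +oo, F (t / 2) <= c * F t.
Proof.
have h20 : 0 < 1 / 2 :> R by lra.
exists ((1 / 2) `^ (- alpha) + 1); split; first by rewrite addr_gt0// powR_gt0.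
have h : (1 / 2) `^ (- alpha) < (1 / 2) `^ (- alpha) + 1 :> R by rewrite ltrDl.
have := F_ratio_le F_gt0 F_ratio h20 h; apply: filterS => t.
by rewrite (_ : 1 / 2 * t = t / 2); last by ring.
Qed.

Let left_tail_half e : 0 < e -> \forall t \near +oo, L (t / 2) <= e * (t * F t).
Proof.
move=> e0; have [c [c0 Hc]] := half_ratio.
have h20 : 0 < 1 / 2 :> R by lra.
have d0 : 0 < 2 * e / c by rewrite divr_gt0// mulr_gt0.
have h : \forall t \near +oo, L (1 / 2 * t) <= 2 * e / c * (1 / 2 * t * F (1 / 2 * t)).
  apply: (@near_pinfty_scale _ (1 / 2) [set t | L t <= 2 * e / c * (t * F t)]) => //.
  exact: left_tail_negligible.
apply: filterS3 near_gt0 h Hc => t t0; rewrite (_ : 1 / 2 * t = t / 2); last by ring.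
move=> h1 h2; apply: le_trans h1 _.
have -> : 2 * e / c * (t / 2 * F (t / 2)) = e * t / c * F (t / 2) by field; rewrite gt_eqF.
have -> : e * (t * F t) = e * t / c * (c * F t) by field; rewrite gt_eqF.
by rewrite ler_wpM2l// divr_ge0 ?mulr_ge0// ltW.
Qed.

(** The shell from -2s to -s contributes at most 2s E(-X; X <= -s) <= 4 s L(s/2), which is o(s^2
    F(s)) by (A2). Unlike on the right, the coefficient [eta] is arbitrarily small. *)
Lemma left_second_moment (eta : R) : 0 < eta -> exists N0 S : R, [/\ 0 <= N0, 0 < S &
  forall t, S <= t -> E `]- t, 0] (fun x : R => x ^+ 2) <= eta * sqF F t + N0].
Proof.
move=> eta0; have [A [S [A0 S0 HA]]] := doubling_bound F_gt0 F_ratio alpha_lt2.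
have e0 : 0 < eta / (4 * A) by rewrite divr_gt0// mulr_gt0.
have [M [_ HM]] := left_tail_half e0.
pose s0 := Num.max S (M + 1).
have s00 : 0 < s0 by rewrite lt_max S0.
pose N s := E `]- s, 0] (fun x : R => x ^+ 2).
exists (N (2 * s0)), s0; split => //; first exact: sqr_ge0_itv.
move=> t s0t.
have -> : eta * sqF F t = A * (eta / A) * sqF F t by congr (_ * _); field; rewrite gt_eqF.
apply: (HA N _ (N (2 * s0)) s0 t) => //.
- by rewrite divr_ge0// ltW.
- exact: sqr_ge0_itv.
- by rewrite le_max lexx.
- move=> s /andP[h1 h2] _; rewrite {2}/N (@E_add (- (2 * s0)) (- s))//; try lra.
  by rewrite lerDr sqr_ge0_itv.
move=> s ss0 _; have sM : M < s by move: ss0; rewrite ge_max => /andP[_]; lra.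
have sp : 0 < s by lra.
rewrite {1}/N (@E_add (- (2 * s)) (- s))//; try lra.
rewrite addrC lerD2l.
apply: le_trans (_ : 2 * s * E `]- (2 * s), - s] (fun x => -1 * x) <= _).
  rewrite /E -EonZ//; apply: le_Eon => //; first by apply: abZ; exact: ab_opp.
  move=> x; rewrite in_itv/= => /andP[x1 x2].
  have : 0 <= (2 * s + x) * - x by rewrite mulr_ge0//; lra.
  by rewrite expr2; lra.
have h1 : E `]- (2 * s), - s] (fun x => -1 * x) <= 2 * L (s / 2).
  apply: le_trans (left_first_moment (ltW sp)).
  rewrite (@E_add_Ny (- (2 * s)) (- s))//; last by lra.
  rewrite lerDr; apply: Eon_ge0 => x; rewrite in_itv/= => x1; lra.
have h2 := HM _ sM.
have s20 : 0 <= 2 * s by lra.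
apply: le_trans (ler_wpM2l s20 h1) _.
have h3 : 2 * s * (2 * L (s / 2)) <= 4 * s * (eta / (4 * A) * (s * F s)).
  have : 4 * s * L (s / 2) <= 4 * s * (eta / (4 * A) * (s * F s)) by rewrite ler_wpM2l//; lra.
  lra.
apply: le_trans h3 _.
by rewrite le_eqVlt; apply/orP; left; apply/eqP; rewrite /sqF; field; rewrite gt_eqF.
Qed.

(** The range is cut at -t. Below, the remainder is at most -X F(t) and the first moment is o(t
    F(t)); above, t - X <= 2t gives access to the Lipschitz bound and the small second moment. *)
Lemma limsup_q_left : limsup_le (fun t => E `]-oo, 0] (q t) / nrm t) 0.
Proof.
have [C [S' [C0 S'0 HC]]] := tail_locally_lipschitz.
move=> e e0; rewrite add0r.
have e40 : 0 < e / 4 by rewrite divr_gt0.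
have eC0 : 0 < e / (4 * C) by rewrite divr_gt0// mulr_gt0.
have [N0 [S [N00 S0 HN]]] := left_second_moment eC0.
have hU := sqF_unbounded F_gt0 F_nonincr F_ratio alpha_lt2 (4 * C * N0 / e).
have hL := left_tail_half e40.
have hs : \forall t \near +oo, S' <= t /\ S <= t.
  by apply: filterS2 (near_ge S') (near_ge S) => t.
apply: filterS2 (filterI near_gt0 hs) (filterI hU hL) => t [t0 [S't St]] [hUt hLt].
have Ft0 : 0 <= F t by exact: tail_ge0.
rewrite (@E_add_Ny (- t) 0)//; last by lra.
have h1 : E `]-oo, - t] (q t) <= e / 2 * nrm t.
  apply: le_trans (_ : F t * E `]-oo, - t] (fun x => -1 * x) <= _).
    rewrite /E -EonZ//; apply: le_Eon => //; first by apply: abZ; exact: ab_opp.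
    move=> x; rewrite in_itv/= => xt; apply: le_trans (q_le t x) _.
    have : 0 <= - x * F (t - x) by rewrite mulr_ge0 ?tail_ge0//; lra.
    by lra.
  have h2 := left_first_moment (ltW t0).
  have h3 : 2 * L (t / 2) <= e / 2 * (t * F t) by lra.
  apply: le_trans (ler_wpM2l Ft0 (le_trans h2 h3)) _.
  by rewrite le_eqVlt; apply/orP; left; apply/eqP; rewrite /nrm; ring.
have CF0 : 0 <= C * (F t / t) by rewrite mulr_ge0 ?divr_ge0// ltW.
have h2 : E `]- t, 0] (q t) <= e / 2 * nrm t.
  apply: le_trans (_ : C * (F t / t) * E `]- t, 0] (fun x : R => x ^+ 2) <= _).
    rewrite /E -EonZ//; apply: le_Eon => //; first by apply: abZ.
    move=> x; rewrite in_itv/= => /andP[x1 x2]; apply: le_trans (q_le t x) _.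
    have h : F t - F (t - x) <= C * (F t / t) * (t - x - t) by apply: HC; lra.
    have x0 : 0 <= - x by lra.
    by have := ler_wpM2l x0 h; rewrite expr2; lra.
  apply: le_trans (ler_wpM2l CF0 (HN _ St)) _.
  have h3 : N0 <= e / (4 * C) * sqF F t.
    have : 4 * C * N0 / e * (e / (4 * C)) <= sqF F t * (e / (4 * C)).
      by rewrite ler_wpM2r// ltW.
    rewrite (_ : 4 * C * N0 / e * (e / (4 * C)) = N0); last by field; rewrite !gt_eqF.
    lra.
  have h4 : e / (4 * C) * sqF F t + N0 <= e / (2 * C) * sqF F t.
    rewrite (_ : e / (2 * C) * sqF F t = e / (4 * C) * sqF F t + e / (4 * C) * sqF F t).
      by lra.
    by field; rewrite gt_eqF.
  apply: le_trans (ler_wpM2l CF0 h4) _.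
  by rewrite le_eqVlt; apply/orP; left; apply/eqP; rewrite /nrm /sqF; field; rewrite !gt_eqF.
rewrite ler_pdivrMr ?nrm_gt0//; lra.
Qed.

(** * Choice of the cut and conclusion *)

Let small_powR (C k : R) : 0 <= C -> 0 < k -> exists e, 0 < e < 1 / 2 /\ C * e `^ (2 - alpha) < k.
Proof.
move=> C0 k0; have p0 : 0 < 2 - alpha by rewrite subr_gt0.
have kC : 0 < k / (C + 1) by rewrite divr_gt0// ltr_wpDl.
have /cvgr_lt/(_ _ kC) h := powR_cvg0 p0.
have h2 : 0 < 1 / 2 :> R by lra.
near (0 : R)^'+ => e; exists e; split.
  by apply/andP; split.
have : e `^ (2 - alpha) < k / (C + 1) by near: e; exact: h.
rewrite ltr_pdivlMr ?ltr_wpDl// => /(le_lt_trans _); apply.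
by rewrite mulrDr mulr1 mulrC lerDl powR_ge0.
Unshelve. all: end_near. Qed.

(** H(s) >= E(X - s) = -m - s >= m, so the minimum in the law of [Z] is 1. *)
Let B_eq1 s : s <= - (2 * m) -> B s = 1.
Proof.
move=> sm; have mp := m_gt0.
have Em : E `]-oo, +oo[ (fun x => x + 2 * m * 1) = m.
  rewrite /E EonD//; [|exact: ab_id|by apply: abZ; exact: ab_cst].
  rewrite EonZ//; last exact: ab_cst.
  by rewrite [Eon _ _ id]EonTid [Eon _ _ _]EonT1; ring.
have Hm : m <= H s.
  rewrite -{1}Em /E EonT; apply: le_Rintegral => //.
  - rewrite (_ : _ \o _ = (fun w => (X w)%:E + cst (2 * m * 1)%:E w)%E); last by apply/funext.
    by apply: integrableD => //; exact: finite_measure_integrable_cst.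
  - exact: maxE.
  - by move=> w _; rewrite le_max; apply/orP; left; lra.
by rewrite B_min min_l// ler_pdivlMr// mul1r.
Qed.

Let c0 := (2 `^ alpha) ^+ 2 / (alpha - 1) * (alpha / (3 - alpha) - 1).

Let products t := H t * F (t / 2) + F t * H (t / 2) + t / 2 * F (t / 2) * F t.

(** Beyond [t], [B <= 1] cancels [F t]; on the middle range [m * B <= H] comes from the minimum.
    Near [t] the function [B] itself is kept, since its bound by 1 is used there. *)
Let tail_excess_le t e : 0 < t -> 0 < e <= 1 / 2 ->
  (forall s, t / 2 <= s -> B s = H s / m) ->
  m * (tail P (fun w => X w + Z w) t - B t) <=
  E `]-oo, 0] (q t) + E `]0, e * t] (q t) + E `]e * t, 1 / 2 * t] (q t)
  + E `]1 / 2 * t, (1 - e) * t] (fun x => H (t - x))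
  + m * E `](1 - e) * t, t] (fun x => B (t - x)) - products t.
Proof.
move=> t0 /andP[e0 e2] BH; have mp := m_gt0.
rewrite (tail_add_expansion BH (ltW t0)) -/(products t).
have et : e * t <= 1 / 2 * t by rewrite ler_pM2r.
have et0 : 0 <= e * t by rewrite mulr_ge0// ltW.
have ht : 1 / 2 * t = t / 2 by ring.
have eqq : E `]-oo, t / 2] (q t) = E `]-oo, 0] (q t) + E `]0, e * t] (q t) + E `]e * t, 1 / 2 * t] (q t).
  by rewrite -ht (@E_add_Ny (e * t))// (@E_add_Ny 0).
have e1 : E `]t / 2, +oo[ (fun x => B (t - x)) =
    E `]t / 2, t] (fun x => B (t - x)) + E `]t, +oo[ (fun x => B (t - x)).
  by apply: (@Eon_split _ _ _ _ _ intX (BRight (t / 2)) +oo%O t) => //; rewrite bnd_simp; lra.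
have e2' : E `]t / 2, t] (fun x => B (t - x)) =
    E `]t / 2, (1 - e) * t] (fun x => B (t - x)) + E `](1 - e) * t, t] (fun x => B (t - x)).
  by apply: E_add => //; lra.
have e3 : E `]t, +oo[ (fun x => B (t - x)) <= F t.
  rewrite -[F t](Eon1_gt X t); apply: le_Eon => //; first exact: ab_cst.
  by move=> x _; exact: tail_le1.
have e4 : m * E `]t / 2, (1 - e) * t] (fun x => B (t - x)) <=
    E `]1 / 2 * t, (1 - e) * t] (fun x => H (t - x)).
  rewrite ht /E -EonZ//; apply: le_Eon => //; first exact: abZ.
  by move=> x _; rewrite mulrC -ler_pdivlMr// B_min ge_min lexx orbT.
rewrite eqq e1 e2' lerD2r -[leRHS]addrA lerD2l.
by have := ler_wpM2l (ltW mp) e3; lra.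
Qed.

(** Nonnegativity of [q] and [B] discards X <= e t and the range from (1-e) t to t + 2m. Past that
    point [B] is exactly 1, so cancelling [F t] costs only F(t) - F(t + 2m). *)
Let tail_excess_ge t e K : 0 < t -> 0 < e <= 1 / 2 ->
  (forall s, e * t <= s -> B s = H s / m) -> F t - F (t + 2 * m) <= K ->
  E `]e * t, 1 / 2 * t] (q t) + E `]1 / 2 * t, (1 - e) * t] (fun x => H (t - x))
  - m * K - products t <= m * (tail P (fun w => X w + Z w) t - B t).
Proof.
move=> t0 /andP[e0 e2] BH FK; have mp := m_gt0.
have et : e * t <= 1 / 2 * t by rewrite ler_pM2r.
have et0 : 0 <= e * t by rewrite mulr_ge0// ltW.
have ht : 1 / 2 * t = t / 2 by ring.
have BH2 s : t / 2 <= s -> B s = H s / m by rewrite -ht => /(le_trans et)/BH.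
rewrite (tail_add_expansion BH2 (ltW t0)) -/(products t).
have eqq : E `]-oo, t / 2] (q t) = E `]-oo, e * t] (q t) + E `]e * t, 1 / 2 * t] (q t).
  by rewrite -ht (@E_add_Ny (e * t)).
have q0 : 0 <= E `]-oo, e * t] (q t) by apply: Eon_ge0 => x _; exact: q_ge0.
have e1 : E `]t / 2, +oo[ (fun x => B (t - x)) =
    E `]t / 2, t + 2 * m] (fun x => B (t - x)) + E `]t + 2 * m, +oo[ (fun x => B (t - x)).
  by apply: (@Eon_split _ _ _ _ _ intX (BRight (t / 2)) +oo%O) => //; rewrite bnd_simp; lra.
have e2' : E `]t / 2, t + 2 * m] (fun x => B (t - x)) =
    E `]t / 2, (1 - e) * t] (fun x => B (t - x)) + E `](1 - e) * t, t + 2 * m] (fun x => B (t - x)).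
  by apply: E_add => //; lra.
have e5 : 0 <= E `](1 - e) * t, t + 2 * m] (fun x => B (t - x)).
  by apply: Eon_ge0 => x _; exact: tail_ge0.
have e3 : F (t + 2 * m) <= E `]t + 2 * m, +oo[ (fun x => B (t - x)).
  rewrite -[F (t + 2 * m)](Eon1_gt X (t + 2 * m)); apply: le_Eon => //; first exact: ab_cst.
  move=> x; rewrite in_itv/= andbT => xt.
  by rewrite B_eq1// lerBlDr addrC -lerBlDr opprK ltW.
have e4 : E `]1 / 2 * t, (1 - e) * t] (fun x => H (t - x)) =
    m * E `]t / 2, (1 - e) * t] (fun x => B (t - x)).
  rewrite ht /E -EonZ//; apply: eq_Eon => x; rewrite in_itv/= => /andP[_ xt].
  rewrite BH; first by rewrite mulrCA divff ?mulr1// gt_eqF.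
  lra.
rewrite eqq e1 e2' e4 lerD2r.
have h : - K <= E `](1 - e) * t, t + 2 * m] (fun x => B (t - x)) +
  E `]t + 2 * m, +oo[ (fun x => B (t - x)) - F t by lra.
by have := ler_wpM2l (ltW mp) h; lra.
Qed.

Let limsup_products : limsup_le (fun t => products t / nrm t)
    (2 `^ alpha / (alpha - 1) + 2 `^ (alpha - 1) / (alpha - 1) + 2 `^ alpha / 2) /\
  limsup_le (fun t => - (products t / nrm t))
    (- (2 `^ alpha / (alpha - 1) + 2 `^ (alpha - 1) / (alpha - 1) + 2 `^ alpha / 2)).
Proof.
split; apply: cvg_limsup_le; first exact: cvg_product_terms.
by apply: cvgN; exact: cvg_product_terms.
Qed.

Lemma tail_add_le : alpha < 3 / 2 ->
  \forall t \near +oo, tail P (fun w => X w + Z w) t <= B t.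
Proof.
move=> a32; have a1 := alpha_gt1.
have nc0 : 0 < - c0.
  rewrite oppr_gt0 /c0 pmulr_rlt0; last by rewrite divr_gt0 ?exprn_gt0 ?powR_gt0// subr_gt0.
  by rewrite subr_lt0 ltr_pdivrMr; lra.
have [C1 C10 H1] := limsup_q_right.
have [C2 C20 H2] := limsup_B_near.
have [C3 C30 H3] := Phi_near0 alpha_gt1 alpha_lt2.
(* The three constants belong to small positive X, to X near t and to the boundary terms; together,
   times e^(2-alpha), they must stay below [- c0]. *)
have [e [e12 eC]] := small_powR (addr_ge0 (addr_ge0 C10 C20) C30) nc0.
have /andP[e0 e2] := e12.
have e12' : 0 < e <= 1 / 2 by rewrite e0 ltW.
have := limsup_leD (limsup_leD (limsup_leD limsup_q_left (H1 e e12'))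
  (limsup_leD ((limsup_q_middle e12).1 (ltW a32)) ((limsup_H_middle e12).1 (ltW a32))))
  (limsup_leD (H2 e e12') limsup_products.2).
set lim := (X in limsup_le _ X) => LL.
have lim0 : lim < 0.
  have := Phi_total alpha_gt1 alpha_lt2; have := H3 e e12'.
  rewrite -/c0 ler_norml /lim => /andP[h _]; clear LL; lra.
have h20 : 0 < 1 / 2 :> R by [].
have [M [_ HM]] := near_BE.
apply: filterS3 near_gt0 (limsup_lt0 lim0 LL) (near_scale_ge (M + 1) h20) => t t0 lt0 Mt.
have nt := nrm_gt0 t0.
rewrite -subr_le0 -(pmulr_rle0 _ m_gt0); apply: le_trans (tail_excess_le t0 e12' _) _.
  by move=> s ts; apply: HM; clear lt0 lim0 LL lim eC; lra.
have {}lt0 := ltW lt0; rewrite -(pmulr_rle0 _ nt) in lt0.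
apply: le_trans lt0; rewrite le_eqVlt; apply/orP; left; apply/eqP.
by field; rewrite gt_eqF.
Qed.

Lemma tail_add_ge : 3 / 2 < alpha ->
  \forall t \near +oo, B t <= tail P (fun w => X w + Z w) t.
Proof.
move=> a32; have a1 := alpha_gt1; have mp := m_gt0.
have c00 : 0 < c0.
  rewrite /c0 pmulr_rgt0; last by rewrite divr_gt0 ?exprn_gt0 ?powR_gt0// subr_gt0.
  have a2 := alpha_lt2; rewrite subr_gt0 ltr_pdivlMr; lra.
have [C3 C30 H3] := Phi_near0 alpha_gt1 alpha_lt2.
have [C [S' [C0 S'0 HC]]] := tail_locally_lipschitz.
have [e [e12 eC]] := small_powR C30 c00.
have /andP[e0 e2] := e12.
have e12' : 0 < e <= 1 / 2 by rewrite e0 ltW.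
(* The loss m (F(t) - F(t + 2m)) is at most m C (F(t)/t) 2m; divided by t F(t)^2 this is the
   constant here over t^2 F(t), which tends to 0. *)
have N00 : 0 <= m * (C * (2 * m)) by rewrite !mulr_ge0// ltW.
have := limsup_leD (limsup_leD ((limsup_q_middle e12).2 (ltW a32))
  ((limsup_H_middle e12).2 (ltW a32)))
  (limsup_leD (limsup_sqF (lexx 0) N00 ltr01) limsup_products.1).
set lim := (X in limsup_le _ X) => LL.
have lim0 : lim < 0.
  have := Phi_total alpha_gt1 alpha_lt2; have := H3 e e12'.
  rewrite -/c0 ler_norml /lim mul0r => /andP[_ h]; clear LL; lra.
have hS : \forall t \near +oo, S' <= t /\ 2 * m <= t.
  by apply: filterS2 (near_ge S') (near_ge (2 * m)) => t.
have [M [_ HM]] := near_BE.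
apply: filterS3 (filterI near_gt0 hS) (limsup_lt0 lim0 LL) (near_scale_ge (M + 1) e0)
  => t [t0 [S't mt]] lt0 Mt.
have nt := nrm_gt0 t0.
have FK : F t - F (t + 2 * m) <= C * (F t / t) * (2 * m).
  rewrite -[leRHS](_ : C * (F t / t) * (t + 2 * m - t) = _); last by rewrite [t + _]addrC addrK.
  by apply: HC => //; clear lt0 lim0 LL lim eC; lra.
rewrite -subr_ge0 -(pmulr_rge0 _ mp); apply: le_trans (tail_excess_ge t0 e12' _ FK); last first.
  by move=> s ts; apply: HM; clear lt0 lim0 LL lim eC; lra.
have {}lt0 := ltW lt0; rewrite -(pmulr_rle0 _ nt) -oppr_ge0 in lt0.
apply: le_trans lt0 _; rewrite le_eqVlt; apply/orP; left; apply/eqP.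
have F0 := F_gt0 t; rewrite /sqF /nrm; field.
by rewrite !gt_eqF.
Qed.

End alpha_lt2.

End residual_life_sum.

Theorem theorem2 (R : realType) (d : measure_display) (T : measurableType d)
    (P : probability T R) (X Z : {RV P >-> R}) (alpha : R) :
  P.-integrable [set: T] (EFin \o X) ->
  ('E_P[X] < 0)%E ->
  1 < alpha ->
  regularly_varying_tail alpha X ->
  negligible_left_tail X ->
  regularly_varying_density alpha X ->
  independent_RV X Z ->
  residual_life X Z ->
  (1 < alpha < 3 / 2 ->
     \forall t \near +oo, tail P (fun w => X w + Z w) t <= tail P Z t) /\
  (3 / 2 < alpha < 2 ->
     \forall t \near +oo, tail P (fun w => X w + Z w) t >= tail P Z t).
Proof.
move=> intX EX alpha1 rvX negX denX indXZ resZ; split=> /andP[ha ha'].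
  have alpha2 : alpha < 2 by lra.
  by apply: (@tail_add_le _ _ _ P X Z alpha).
by apply: (@tail_add_ge _ _ _ P X Z alpha).
Qed.
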